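(* Let $(\mathcal{M},\mathbf{g})$ be a four-dimensional pseudo-Riemannian manifold with a $2$-dimensional Abelian Killing algebra $\mathcal{G}_2=\langle\xi_{(1)},\xi_{(2)}\rangle$, $[\xi_{(1)},\xi_{(2)}]=0$, whose Killing leaves are non-null and orthogonally intransitive, and let $X$ be a vector field and $\Lambda\in\mathbb{R}$ a constant such that $\mathrm{Ric}(\mathbf{g})+\frac12 L_X\mathbf{g}=\Lambda\mathbf{g}$. Assume that (i) the curvature vector field $\mathcal{C}$ satisfies $\mathbf{g}(\mathcal{C},\mathcal{C})=0$; (ii) $\mathcal{G}_2$ has a null vector; (iii) $X\in\Xi=\mathrm{span}\{\xi_{(1)},\xi_{(2)}\}$ and $X$ is a symmetry of $\Xi^\perp$. Let $\mathbf{g}$ be written in adapted coordinates in the normal form (N) described in the context, and assume $\partial f_1^1/\partial t_2\neq 0$. Then, locally, for a suitable choice of adapted coordinates $\{t_1,t_2,z_1,z_2\}$, the Ricci soliton can be written in the form $$\mathbf{g}=e^{-2P}\left(dt_1^2+\epsilon_0\,dt_2^2\right)-2\left(\int e^{-2P}dt_2\right)\left(c\,dt_1dz_1-dt_1dz_2\right)-2c\,dz_1^2+2\,dz_1dz_2$$ with $$X=\left(\frac{\epsilon_0 c}{2}z_1-\frac{\epsilon_0}{2}z_2+a_1\right)\partial_{z_1}+\left(\left(\frac{\epsilon_0c^2}{2}-2\Lambda c\right)z_1+\left(2\Lambda-\frac{\epsilon_0c}{2}\right)z_2+a_2\right)\partial_{z_2},$$ where $\Lambda,c,a_1,a_2\in\mathbb{R}$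 are arbitrary constants, $\epsilon_0=\pm1$, and $P=P(t_1,t_2)$ is a differentiable function satisfying $$\partial_{t_1}^2P+\epsilon_0\,\partial_{t_2}^2P=\Lambda e^{-2P}.$$ In particular, the Ricci soliton can be either expanding ($\Lambda<0$), steady ($\Lambda=0$) or shrinking ($\Lambda>0$), and the orbit metric $\tilde{\mathbf{g}}=e^{-2P}(dt_1^2+\epsilon_0dt_2^2)$ has constant Gauss curvature $\Lambda$.
   Context: All statements are local and all functions are differentiable (as often as needed). $L_X$ is the Lie derivative; $\int e^{-2P}dt_2$ denotes an antiderivative of $e^{-2P}$ with respect to $t_2$. Killing algebra and adapted coordinates. $\mathcal{G}_2$ is a 2-dimensional Abelian Lie algebra of Killing fields of $\mathbf{g}$, spanned by pointwise linearly independent commuting fields $\xi_{(1)},\xi_{(2)}$; $\Xi=\mathrm{span}\{\xi_{(1)},\xi_{(2)}\}$ is the distribution they generate, its integral surfaces are the Killing leaves, and $\Xi^\perp$ is the orthogonal distribution. Adapted coordinates are local coordinates $\{t_1,t_2,z_1,z_2\}$ such that $\mathcal{G}_2$ is generated by $\partial_{z_1},\partial_{z_2}$ (so $\xi_{(i)}=\partial_{z_i}$ for a basis) and the Killing leaves are the surfaces $t_1,t_2=$ const. In adapted coordinates, when the Killing leaves are non-null (i.e. $\det(h_{kl})\ne0$), $$\mathbf{g}=\tilde g_{ij}\,dt_idt_j+h_{kl}\,(dz_k+f_i^kdt_i)(dz_l+f_j^ldt_j),$$ with $\tilde g_{ij},h_{kl},f_i^k$ functions of $(t_1,t_2)$,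 summation over repeated indices. The orbit metric is $\tilde{\mathbf{g}}=\tilde g_{ij}dt_idt_j$ (a metric on the local orbit space), and its Gauss curvature $K$ is normalised by $\mathrm{Ric}(\tilde{\mathbf g})=K\tilde{\mathbf g}$. Curvature vector field: $\mathcal{C}=\mathcal{C}^1\partial_{z_1}+\mathcal{C}^2\partial_{z_2}$ with $\mathcal{C}^k=(\partial_{t_2}f_1^k-\partial_{t_1}f_2^k)/\sqrt{|\det\tilde{\mathbf{g}}|}$; so $\mathbf{g}(\mathcal{C},\mathcal{C})=h_{kl}\mathcal{C}^k\mathcal{C}^l$. Orthogonally intransitive means $\Xi^\perp$ is not integrable, i.e. $\mathcal{C}\neq0$. Condition (ii): $\mathcal{G}_2$ contains a nonzero Killing field that is everywhere null. Condition (iii): $X$ is tangent to the Killing leaves, and $[X,Y]$ is a section of $\Xi^\perp$ for every section $Y$ of $\Xi^\perp$. Normal form (N). Under these assumptions adapted coordinates are chosen such that $\xi_{(2)}=\partial_{z_2}$ is null and $f_2^1=f_2^2=0$, with $$\mathbf{g}=e^{-2P}(dt_1^2+\epsilon_0dt_2^2)+h_{11}(dz_1+f_1^1dt_1)^2+2h_{12}(dz_1+f_1^1dt_1)(dz_2+f_1^2dt_1),$$ where $\epsilon_0=\pm1$, $P,h_{11},h_{12},f_1^1,f_1^2$ are functions of $(t_1,t_2)$, $h_{12}\neq0$ and $(\partial_{t_2}f_1^1)^2+(\partial_{t_2}f_1^2)^2\neq0$. *)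

(* Defs.v *)
From Stdlib Require Import Reals List.
From Coquelicot Require Import Coquelicot.
Open Scope R_scope.

Set Implicit Arguments.

(** * Local tensor calculus

    Everything is local, so a manifold is an open set [U] of the coordinate
    space [I -> R], for a finite index type [I] of coordinates; Coquelicot
    equips [I -> R] with the supremum uniform structure.  Scalar fields are
    total functions of which only the values on [U] are used. *)

Class Index (I : Type) := {
  ix_dec : forall i j : I, {i = j} + {i <> j};
  ix_sum : (I -> R) -> R
}.

(** The indices 1, 2 of the coordinates t_1, t_2, of the coordinates
    z_1, z_2, and of the Killing fields. *)
Inductive two : Set := i1 | i2.

#[global] Instance two_index : Index two := {
  ix_dec := ltac:(decide equality);
  ix_sum F := F i1 + F i2
}.

(** In [two + two] the index [inl i] is that of t_i, and [inr k] that of z_k. *)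
#[global] Instance sum_index (I J : Type) (_ : Index I) (_ : Index J) :
  Index (I + J) := {
  ix_dec := ltac:(decide equality; apply ix_dec);
  ix_sum F := ix_sum (fun i => F (inl i)) + ix_sum (fun j => F (inr j))
}.

Section Tensors.
Context {I : Type} {HI : Index I}.

Definition scalar := (I -> R) -> R.
Definition vfield := I -> scalar.
Definition tensor2 := I -> I -> scalar.

Definition kron (i j : I) : R := if ix_dec i j then 1 else 0.

Definition upd (x : I -> R) (i : I) (s : R) : I -> R :=
  fun j => if ix_dec j i then s else x j.

Definition pd (i : I) (f : scalar) : scalar :=
  fun x => Derive (fun s => f (upd x i s)) (x i).

(** C^infinity on an open set: all iterated partial derivatives exist and are
    continuous. *)
Definition smooth (U : (I -> R) -> Prop) (f : scalar) : Prop :=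
  forall (l : list I) (x : I -> R), U x ->
    continuous (fold_right pd f l) x /\
    forall i, ex_derive (fun s => fold_right pd f l (upd x i s)) (x i).

Definition smooth_vfield (U : (I -> R) -> Prop) (X : vfield) : Prop :=
  forall i, smooth U (X i).

(** [gi] is the inverse matrix g^{ij} of g_{ij}; its existence is the
    nondegeneracy of [g].  The signature is arbitrary. *)
Record pseudo_metric (U : (I -> R) -> Prop) (g gi : tensor2) : Prop := {
  metric_smooth : forall i j, smooth U (g i j);
  metric_sym : forall i j x, U x -> g i j x = g j i x;
  metric_inv : forall i k x, U x ->
    ix_sum (fun j => g i j x * gi j k x) = kron i k
}.

Definition inner (g : tensor2) (X Y : vfield) : scalar := fun x =>
  ix_sum (fun i => ix_sum (fun j => g i j x * X i x * Y j x)).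

(** Christoffel symbol Gamma^k_{ij} of the Levi-Civita connection. *)
Definition christoffel (g gi : tensor2) (k i j : I) : scalar := fun x =>
  / 2 * ix_sum (fun l =>
    gi k l x * (pd i (g j l) x + pd j (g i l) x - pd l (g i j) x)).

(** The sign is the one for which round spheres have positive Ricci
    curvature. *)
Definition ricci (g gi : tensor2) : tensor2 := fun i j x =>
  ix_sum (fun k =>
    pd k (christoffel g gi k i j) x - pd j (christoffel g gi k i k) x
    + ix_sum (fun l =>
        christoffel g gi k k l x * christoffel g gi l i j x
        - christoffel g gi k j l x * christoffel g gi l i k x)).

Definition lie_tensor2 (X : vfield) (g : tensor2) : tensor2 := fun i j x =>
  ix_sum (fun k =>
    X k x * pd k (g i j) x + g k j x * pd i (X k) x + g i k x * pd j (X k) x).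

Definition bracket (X Y : vfield) : vfield := fun k x =>
  ix_sum (fun l => X l x * pd l (Y k) x - Y l x * pd l (X k) x).

Definition coord_field (i : I) : vfield := fun j _ => kron i j.

Definition killing (U : (I -> R) -> Prop) (g : tensor2) (X : vfield) : Prop :=
  smooth_vfield U X /\ forall i j x, U x -> lie_tensor2 X g i j x = 0.

Definition ricci_soliton (U : (I -> R) -> Prop) (g gi : tensor2) (X : vfield)
    (Lambda : R) : Prop :=
  smooth_vfield U X /\
  forall i j x, U x ->
    ricci g gi i j x + / 2 * lie_tensor2 X g i j x = Lambda * g i j x.

Definition comb (a : two -> R) (xi : two -> vfield) : vfield := fun j x =>
  ix_sum (fun k => a k * xi k j x).

Definition independent (U : (I -> R) -> Prop) (xi : two -> vfield) : Prop :=
  forall x, U x -> forall a : two -> R,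
    (forall j, comb a xi j x = 0) -> forall k, a k = 0.

Definition abelian_killing_algebra (U : (I -> R) -> Prop) (g : tensor2)
    (xi : two -> vfield) : Prop :=
  (forall k, killing U g (xi k)) /\
  (forall j x, U x -> bracket (xi i1) (xi i2) j x = 0) /\
  independent U xi.

Definition in_span (U : (I -> R) -> Prop) (xi : two -> vfield) (X : vfield)
    : Prop :=
  forall x, U x -> exists a : two -> R, forall j, X j x = comb a xi j x.

Definition orth_section (U : (I -> R) -> Prop) (g : tensor2)
    (xi : two -> vfield) (Y : vfield) : Prop :=
  smooth_vfield U Y /\ forall k x, U x -> inner g Y (xi k) x = 0.

Definition symmetry_of_orth (U : (I -> R) -> Prop) (g : tensor2)
    (xi : two -> vfield) (X : vfield) : Prop :=
  forall Y, orth_section U g xi Y -> orth_section U g xi (bracket X Y).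

Definition has_null_vector (U : (I -> R) -> Prop) (g : tensor2)
    (xi : two -> vfield) : Prop :=
  exists a : two -> R, (exists k, a k <> 0) /\
    forall x, U x -> inner g (comb a xi) (comb a xi) x = 0.

Definition det2 (m : two -> two -> R) : R :=
  m i1 i1 * m i2 i2 - m i1 i2 * m i2 i1.

Definition nonnull_leaves (U : (I -> R) -> Prop) (g : tensor2)
    (xi : two -> vfield) : Prop :=
  forall x, U x -> det2 (fun k l => inner g (xi k) (xi l) x) <> 0.

Definition diffeo (V W : (I -> R) -> Prop) (phi psi : (I -> R) -> I -> R)
    : Prop :=
  (forall i, smooth V (fun x => phi x i)) /\
  (forall i, smooth W (fun y => psi y i)) /\
  (forall x, V x -> W (phi x) /\ psi (phi x) = x) /\
  (forall y, W y -> V (psi y) /\ phi (psi y) = y).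

Definition pushforward (phi : (I -> R) -> I -> R) (X : vfield) : vfield :=
  fun i x => ix_sum (fun a => X a x * pd a (fun y => phi y i) x).

Definition pullback (phi : (I -> R) -> I -> R) (g : tensor2) : tensor2 :=
  fun a b x => ix_sum (fun i => ix_sum (fun j =>
    g i j (phi x) * pd a (fun y => phi y i) x * pd b (fun y => phi y j) x)).

End Tensors.

Arguments scalar : clear implicits.
Arguments vfield : clear implicits.
Arguments tensor2 : clear implicits.

(** The metric [g] has Gauss curvature [K], normalised by Ric(g) = K g. *)
Definition gauss_curvature (D : (two -> R) -> Prop) (g : tensor2 two)
    (K : scalar two) : Prop :=
  exists gi, pseudo_metric D g gi /\
    forall i j t, D t -> ricci g gi i j t = K t * g i j t.

(** * Adapted coordinates *)

Definition tpart (x : two + two -> R) : two -> R := fun i => x (inl i).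

(** The range of (t_1, t_2) over [U], i.e. the local orbit space. *)
Definition orbit_space (U : (two + two -> R) -> Prop) (t : two -> R) : Prop :=
  exists x, U x /\ tpart x = t.

(** The Killing fields become the constant combinations, by an invertible
    matrix, of d/dz_1 and d/dz_2. *)
Definition adapted_chart (V : (two + two -> R) -> Prop)
    (xi : two -> vfield (two + two))
    (phi : (two + two -> R) -> two + two -> R) : Prop :=
  exists A : two -> two -> R, det2 A <> 0 /\
    forall k j x, V x ->
      pushforward phi (xi k) j x = match j with inl _ => 0 | inr l => A k l end.

(** gt_ij dt_i dt_j + h_kl (dz_k + f_i^k dt_i)(dz_l + f_j^l dt_j), with
    [f i k] for f_i^k. *)
Definition adapted_metric (gt h f : tensor2 two) : tensor2 (two + two) :=
  fun a b x => let t := tpart x in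
  match a, b with
  | inl i, inl j =>
      gt i j t + ix_sum (fun k => ix_sum (fun l => h k l t * f i k t * f j l t))
  | inl i, inr l => ix_sum (fun k => h k l t * f i k t)
  | inr k, inl j => ix_sum (fun l => h k l t * f j l t)
  | inr k, inr l => h k l t
  end.

Definition curvature_coef (gt f : tensor2 two) (k : two) : scalar two :=
  fun t => (pd i2 (f i1 k) t - pd i1 (f i2 k) t)
           / sqrt (Rabs (det2 (fun i j => gt i j t))).

Definition curvature_field (gt f : tensor2 two) : vfield (two + two) :=
  fun a x => match a with
             | inl _ => 0
             | inr k => curvature_coef gt f k (tpart x)
             end.

(** e^{-2P} (dt_1^2 + eps dt_2^2) *)
Definition conformal_metric (eps : R) (P : scalar two) : tensor2 two :=
  fun i j t => match i, j with
               | i1, i1 => exp (- 2 * P t)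
               | i2, i2 => eps * exp (- 2 * P t)
               | _, _ => 0
               end.

(** The coordinates of [U] are themselves adapted: [nks_coord] makes xi_(k) the
    field d/dz_k, and [gt], [h], [f] are the functions of (t_1, t_2) of the
    adapted form of [g]. *)
Record null_killing_soliton (U : (two + two -> R) -> Prop)
    (g gi : tensor2 (two + two)) (xi : two -> vfield (two + two))
    (gt h f : tensor2 two) (X : vfield (two + two)) (Lambda : R) : Prop := {
  nks_open : open U;
  nks_metric : pseudo_metric U g gi;
  nks_killing : abelian_killing_algebra U g xi;
  nks_nonnull : nonnull_leaves U g xi;
  nks_coord : forall k a x, U x -> xi k a x = coord_field (inr k) a x;
  nks_smooth : forall i j, smooth (orbit_space U) (gt i j) /\
    smooth (orbit_space U) (h i j) /\ smooth (orbit_space U) (f i j);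
  nks_adapted : forall a b x, U x -> g a b x = adapted_metric gt h f a b x;
  nks_intransitive : forall x, U x -> exists a, curvature_field gt f a x <> 0;
  nks_soliton : ricci_soliton U g gi X Lambda;
  nks_null_curvature : forall x, U x ->
    inner g (curvature_field gt f) (curvature_field gt f) x = 0;
  nks_null_vector : has_null_vector U g xi;
  nks_tangent : in_span U xi X;
  nks_symmetry : symmetry_of_orth U g xi X
}.

(** The normal form
    e^{-2P} (dt_1^2 + eps dt_2^2) + h_11 (dz_1 + f_1^1 dt_1)^2
      + 2 h_12 (dz_1 + f_1^1 dt_1) (dz_2 + f_1^2 dt_1)
    over the orbit space [D]. *)
Record normal_form (D : (two -> R) -> Prop) (eps : R) (P : scalar two)
    (gt h f : tensor2 two) : Prop := {
  nf_eps : eps = 1 \/ eps = -1;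
  nf_P : smooth D P;
  nf_gt : forall i j t, D t -> gt i j t = conformal_metric eps P i j t;
  nf_h21 : forall t, D t -> h i2 i1 t = h i1 i2 t;
  nf_h22 : forall t, D t -> h i2 i2 t = 0;
  nf_f2 : forall k t, D t -> f i2 k t = 0;
  nf_h12 : forall t, D t -> h i1 i2 t <> 0;
  nf_curv : forall t, D t -> pd i2 (f i1 i1) t ^ 2 + pd i2 (f i1 i2) t ^ 2 <> 0
}.

(** e^{-2P} (dt_1^2 + eps dt_2^2) - 2 F (c dt_1 dz_1 - dt_1 dz_2)
    - 2 c dz_1^2 + 2 dz_1 dz_2, where dt dz is the symmetric product, so that
    off-diagonal components are half of the coefficients. *)
Definition soliton_metric (eps c : R) (P F : scalar two)
    : tensor2 (two + two) :=
  fun a b x => let t := tpart x in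
  match a, b with
  | inl i, inl j => conformal_metric eps P i j t
  | inl i1, inr i1 | inr i1, inl i1 => - c * F t
  | inl i1, inr i2 | inr i2, inl i1 => F t
  | inr i1, inr i1 => - 2 * c
  | inr i1, inr i2 | inr i2, inr i1 => 1
  | _, _ => 0
  end.

Definition soliton_field (eps Lambda c a1 a2 : R) : vfield (two + two) :=
  fun a x =>
  match a with
  | inl _ => 0
  | inr i1 => eps * c / 2 * x (inr i1) - eps / 2 * x (inr i2) + a1
  | inr i2 => (eps * c ^ 2 / 2 - 2 * Lambda * c) * x (inr i1)
              + (2 * Lambda - eps * c / 2) * x (inr i2) + a2
  end.

(** [F] is an antiderivative of e^{-2P} with respect to t_2. *)
Record soliton_data (D : (two -> R) -> Prop) (eps Lambda : R)
    (P F : scalar two) : Prop := {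
  sd_P : smooth D P;
  sd_F : smooth D F;
  sd_antiderivative : forall t, D t -> pd i2 F t = exp (- 2 * P t);
  sd_pde : forall t, D t ->
    pd i1 (pd i1 P) t + eps * pd i2 (pd i2 P) t = Lambda * exp (- 2 * P t)
}.

(* Main.v *)
Require Import Defs.
From Stdlib Require Import Reals List.
From Coquelicot Require Import Coquelicot.
From Stdlib Require Import Lra FunctionalExtensionality.
Open Scope R_scope.

(** Since [X] is vertical and a symmetry of the orthogonal distribution, it is
    annihilated by the horizontal lifts of d/dt_i, hence also by their
    commutator, which is proportional to the curvature field C.  So the lifts
    and the leaves see two separate sets of Ricci equations: Ric(e_i, d/dz_k)
    = 0 says that h_12 h_kl C^l is constant, and Ric(d/dz_2, d/dz_2) gives
    d X^1/dz_2 = - eps h_12 (C^1)^2 / 2.  The left-hand side is annihilated by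
    the lifts and depends on t only, so it is constant.  Together with the
    constancy of h_12^2 C^1 this makes h_12, C^1 and then h_11 constant.  The
    remaining equations are the one for P and a linear system for the
    z-derivatives of [X].  A change of the coordinates z_k that is affine with
    coefficients depending on t_1 puts the metric in the stated form; the
    freedom of adding a multiple of z_1 to z_2 even allows c = 0. *)

(** The obstacle is computational: the Ricci tensor of a metric with five unknown functions of (t_1,
    t_2) has to be brought to closed form. The metric coefficients are therefore reified as formal
    expressions, and the identities between their derivatives are left to [field]. For general h_11
    and h_12 only the few components named above are extracted; the whole tensor is computed
    afterwards, when the leaf metric and C are constant. Geometrically, a leaf metric with h_22 = 0
    has two null directions, d/dz_2 and d/dz_1 + r d/dz_2 with h_11 = -2 r h_12. As C^1 is nonzero,
    g(C,C) = 0 puts C into the second one. With th_k = dz_k + f_1^k dt_1 the leaf part of the metric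
    is 2 h_12 th_1 (th_2 - r th_1), and for constant r the form th_2 - r th_1 is closed because C^2
    = r C^1. Its primitive, up to a factor, is the new coordinate z_2. *)

(** * Partial derivatives and smooth functions on open sets *)

Section Calculus.
Context {I : Type} {HI : Index I}.
Implicit Types (U : (I -> R) -> Prop) (x : I -> R) (f g : scalar I).

Lemma upd_eq x i s : upd x i s i = s.
Proof. unfold upd. now destruct (ix_dec i i). Qed.

Lemma upd_neq x i j s : j <> i -> upd x i s j = x j.
Proof. unfold upd. now destruct (ix_dec j i). Qed.

Lemma upd_id x i : upd x i (x i) = x.
Proof.
  apply functional_extensionality; intros j; unfold upd.
  destruct (ix_dec j i); now subst.
Qed.

Lemma continuous_coord i x : continuous (fun y : I -> R => y i) x.
Proof.
  apply filterlim_locally; intros eps. exists eps; intros y Hy. apply Hy.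
Qed.

Lemma continuous_upd x i s : continuous (fun r : R => upd x i r) s.
Proof.
  apply filterlim_locally; intros eps. exists eps; intros r Hr j.
  unfold upd. destruct (ix_dec j i); [exact Hr | apply ball_center].
Qed.

Lemma locally_upd U x i : open U -> U x -> locally (x i) (fun s => U (upd x i s)).
Proof.
  intros oU Ux. apply (continuous_upd x i (x i) U).
  rewrite upd_id. now apply oU.
Qed.

Lemma pd_ext_loc U f g : open U -> (forall x, U x -> f x = g x) ->
  forall i x, U x -> pd i f x = pd i g x.
Proof.
  intros oU fg i x Ux. apply Derive_ext_loc.
  generalize (locally_upd U x i oU Ux). apply filter_imp; auto.
Qed.

Lemma pd_ext f g : (forall x, f x = g x) -> forall i x, pd i f x = pd i g x.
Proof. intros fg i x. apply Derive_ext; auto. Qed.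

Lemma pd_const (c : R) i x : pd i (fun _ => c) x = 0.
Proof. unfold pd. apply Derive_const. Qed.

Lemma pd_coord i j x : pd i (fun y => y j) x = kron i j.
Proof.
  unfold pd, kron, upd. destruct (ix_dec j i) as [-> | ne].
  - destruct (ix_dec i i); [apply Derive_id | easy].
  - destruct (ix_dec i j); [now subst | apply Derive_const].
Qed.

Lemma smooth_continuous U f x : smooth U f -> U x -> continuous f x.
Proof. intros Hf Ux. apply (Hf nil x Ux). Qed.

Lemma smooth_ex_derive U f x i : smooth U f -> U x ->
  ex_derive (fun s => f (upd x i s)) (x i).
Proof. intros Hf Ux. apply (Hf nil x Ux). Qed.

Lemma smooth_pd U f i : smooth U f -> smooth U (pd i f).
Proof.
  intros Hf l. generalize (Hf (l ++ i :: nil)). now rewrite fold_right_app.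
Qed.

Lemma smooth_mono (U V : (I -> R) -> Prop) f :
  (forall x, V x -> U x) -> smooth U f -> smooth V f.
Proof. intros VU Hf l x Vx. apply Hf; auto. Qed.

(* Coinduction: a class of functions that is closed under partial derivatives
   up to equality on [U] consists of smooth functions. *)
Lemma smooth_coind U (S : scalar I -> Prop) : open U ->
  (forall f x, S f -> U x -> continuous f x /\
    forall i, ex_derive (fun s => f (upd x i s)) (x i)) ->
  (forall f i, S f -> exists g, S g /\ forall x, U x -> pd i f x = g x) ->
  forall f, S f -> smooth U f.
Proof.
  intros oU HS Hpd f Sf l.
  assert (exists g, S g /\ forall x, U x -> fold_right pd f l x = g x)
    as [g [Sg fg]].
  { induction l as [| i l [g [Sg fg]]]; simpl.
    - now exists f.
    - destruct (Hpd g i Sg) as [g' [Sg' gg']]. exists g'; split; [easy |].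
      intros x Ux. rewrite (pd_ext_loc U _ g); auto. }
  intros x Ux. destruct (HS g x Sg Ux) as [cg dg]. split.
  - apply (continuous_ext_loc _ g x); [| easy].
    generalize (oU x Ux). apply filter_imp. intros; symmetry; auto.
  - intros i. apply (ex_derive_ext_loc (fun s => g (upd x i s))); [| easy].
    generalize (locally_upd U x i oU Ux). apply filter_imp.
    intros; symmetry; auto.
Qed.

Lemma smooth_ext U f g : open U -> (forall x, U x -> f x = g x) ->
  smooth U f -> smooth U g.
Proof.
  intros oU fg Hf.
  apply (smooth_coind U
    (fun g => exists f, smooth U f /\ forall x, U x -> f x = g x) oU);
    [| | now exists f].
  - clear - oU. intros g x [f [Hf fg]] Ux. split.
    + apply (continuous_ext_loc g f x); [| now apply (smooth_continuous U)].
      generalize (oU x Ux). apply filter_imp; auto.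
    + intros i. apply (ex_derive_ext_loc (fun s => f (upd x i s)));
        [| now apply (smooth_ex_derive U)].
      generalize (locally_upd U x i oU Ux). apply filter_imp; auto.
  - clear - oU. intros g i [f [Hf fg]]. exists (pd i f). split.
    + exists (pd i f). split; [now apply smooth_pd | easy].
    + intros x Ux. symmetry. now apply (pd_ext_loc U).
Qed.

(** Serves the functions that formal expressions do not produce: the coordinates, a logarithm, and
    the antiderivative [Bx]. Their first derivatives are already known to be smooth. *)
Lemma smooth_of_pd U f : open U ->
  (forall x, U x -> continuous f x /\
    forall i, ex_derive (fun s => f (upd x i s)) (x i)) ->
  (forall i, exists g, smooth U g /\ forall x, U x -> pd i f x = g x) ->
  smooth U f.
Proof.
  intros oU Hf Hpd.
  apply (smooth_coind U (fun g => g = f \/ smooth U g) oU); [| | now left].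
  - intros g x [-> | Hg] Ux; [auto |].
    apply (Hg nil x Ux).
  - intros g i [-> | Hg].
    + destruct (Hpd i) as [g [Hg e]]. eauto.
    + exists (pd i g). split; [right; now apply smooth_pd | easy].
Qed.

(** * Formal expressions and their formal partial derivatives *)

(** [Zero] is kept apart from [Cst 0] because [simp] discards vanishing terms by pattern matching,
    and real constants cannot be matched on. *)
Inductive fexp :=
| Zero
| Cst (c : R)
| Fn (f : scalar I)
| Add (a b : fexp)
| Mul (a b : fexp)
| Inv (a : fexp)
| Exp (a : fexp).

Fixpoint eval (e : fexp) (x : I -> R) : R :=
  match e with
  | Zero => 0
  | Cst c => c
  | Fn f => f x
  | Add a b => eval a x + eval b x
  | Mul a b => eval a x * eval b x
  | Inv a => / eval a x
  | Exp a => exp (eval a x)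
  end.

Fixpoint wf U (e : fexp) : Prop :=
  match e with
  | Zero | Cst _ => True
  | Fn f => smooth U f
  | Add a b | Mul a b => wf U a /\ wf U b
  | Inv a => wf U a /\ forall x, U x -> eval a x <> 0
  | Exp a => wf U a
  end.

Fixpoint fD (i : I) (e : fexp) : fexp :=
  match e with
  | Zero | Cst _ => Zero
  | Fn f => Fn (pd i f)
  | Add a b => Add (fD i a) (fD i b)
  | Mul a b => Add (Mul (fD i a) b) (Mul a (fD i b))
  | Inv a => Mul (Cst (-1)) (Mul (fD i a) (Mul (Inv a) (Inv a)))
  | Exp a => Mul (fD i a) (Exp a)
  end.

(* Without the removal of zeros, the Ricci tensor is too large for [field]. *)
Fixpoint simp (e : fexp) : fexp :=
  match e with
  | Zero | Cst _ | Fn _ => e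
  | Add a b =>
      match simp a, simp b with
      | Zero, b => b
      | a, Zero => a
      | a, b => Add a b
      end
  | Mul a b =>
      match simp a, simp b with
      | Zero, _ | _, Zero => Zero
      | a, b => Mul a b
      end
  | Inv a => Inv (simp a)
  | Exp a => Exp (simp a)
  end.

Lemma eval_simp e x : eval (simp e) x = eval e x.
Proof.
  induction e as [| c | f | a IHa b IHb | a IHa b IHb | a IHa | a IHa];
    simpl; auto.
  - rewrite <- IHa, <- IHb. destruct (simp a), (simp b); simpl; ring.
  - rewrite <- IHa, <- IHb. destruct (simp a), (simp b); simpl; ring.
  - now rewrite IHa.
  - now rewrite IHa.
Qed.

Lemma wf_fD U i e : wf U e -> wf U (fD i e).
Proof.
  induction e; simpl; try tauto. now apply smooth_pd.
Qed.

Lemma wf_mono (U V : (I -> R) -> Prop) e :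
  (forall x, V x -> U x) -> wf U e -> wf V e.
Proof.
  intros VU. induction e; simpl; intuition; eauto using smooth_mono.
Qed.

Lemma eval_correct U e x : wf U e -> U x ->
  continuous (eval e) x /\
  forall i, is_derive (fun s => eval e (upd x i s)) (x i) (eval (fD i e) x).
Proof.
  intros He Ux. induction e as [| c | f | a IHa b IHb | a IHa b IHb | a IHa | a IHa];
    simpl in He |- *.
  - split; [apply continuous_const | intros i; apply (is_derive_const 0)].
  - split; [apply continuous_const | intros i; apply (is_derive_const c)].
  - split; [now apply (smooth_continuous U) |].
    intros i. apply Derive_correct. now apply (smooth_ex_derive U).
  - destruct IHa as [ca da]; [easy |]. destruct IHb as [cb db]; [easy |].
    split; [now apply (continuous_plus (eval a) (eval b)) |].
    intros i. now apply (is_derive_plus (fun s => eval a (upd x i s))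
      (fun s => eval b (upd x i s))).
  - destruct IHa as [ca da]; [easy |]. destruct IHb as [cb db]; [easy |].
    split; [now apply (continuous_mult (eval a) (eval b)) |].
    intros i. generalize (is_derive_mult _ _ _ _ _ (da i) (db i) Rmult_comm).
    rewrite !upd_id. now intros d.
  - destruct He as [wa na]. destruct IHa as [ca da]; [easy |].
    split.
    + apply (continuous_comp (eval a) Rinv); [easy |].
      apply continuous_Rinv. now apply na.
    + intros i. evar_last.
      * apply (is_derive_inv (fun s => eval a (upd x i s))); [apply da |].
        rewrite upd_id. now apply na.
      * rewrite upd_id. field. now apply na.
  - destruct IHa as [ca da]; [easy |].
    split.
    + apply (continuous_comp (eval a) exp); [easy |].
      apply continuous_exp.
    + intros i. evar_last.
      * apply (is_derive_comp exp (fun s => eval a (upd x i s))); [| apply da].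
        apply is_derive_exp.
      * now rewrite upd_id.
Qed.

Lemma pd_eval U e i x : wf U e -> U x -> pd i (eval e) x = eval (fD i e) x.
Proof.
  intros He Ux. apply is_derive_unique. now apply (eval_correct U e x He Ux).
Qed.

Lemma smooth_eval U e : open U -> wf U e -> smooth U (eval e).
Proof.
  intros oU He.
  apply (smooth_coind U (fun f => exists e, wf U e /\ f = eval e) oU);
    [| | now exists e].
  - clear - oU. intros f x [e [He ->]] Ux. destruct (eval_correct U e x He Ux) as [c d].
    split; [easy |]. intros i. eexists. apply d.
  - clear - oU. intros f i [e [He ->]]. exists (eval (fD i e)). split.
    + exists (fD i e). split; [now apply wf_fD | easy].
    + intros x Ux. now apply (pd_eval U).
Qed.

Lemma smooth_const U (c : R) : open U -> smooth U (fun _ => c).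
Proof. intros oU. now apply (smooth_eval U (Cst c)). Qed.

Lemma smooth_coord U i : open U -> smooth U (fun x => x i).
Proof.
  intros oU. apply smooth_of_pd; [easy | |].
  - intros x _. split; [apply continuous_coord |].
    intros j. unfold upd. destruct (ix_dec i j).
    + apply ex_derive_id.
    + apply ex_derive_const.
  - intros j. exists (fun _ => kron j i). split; [now apply smooth_const |].
    intros x _. apply pd_coord.
Qed.

Lemma pd_pd_comm U f i j x : open U -> smooth U f -> U x ->
  pd i (pd j f) x = pd j (pd i f) x.
Proof.
  intros oU Hf Ux. destruct (ix_dec i j) as [-> | ne]; [easy |].
  (* The plane through x in the directions i and j. Schwarz's theorem for functions of two real
     variables is applied on it, and the assertions below translate derivatives in u and v into
     [pd i] and [pd j]. *)
  set (q := fun u v : R => upd (upd x i u) j v).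
  assert (cq : forall u v, forall W, locally (q u v) W ->
    locally_2d (fun u v => W (q u v)) u v).
  { intros u v W [d Hd]. exists d. intros u' v' Hu Hv. apply Hd.
    intros k. unfold q, upd. destruct (ix_dec k j); [exact Hv |].
    destruct (ix_dec k i); [exact Hu | apply ball_center]. }
  assert (swap : forall u v, q u v = upd (upd x j v) i u).
  { intros u v. apply functional_extensionality; intros k. unfold q, upd.
    destruct (ix_dec k j), (ix_dec k i); congruence. }
  assert (q1 : forall u v u', q u' v = upd (q u v) i u').
  { intros u v u'. apply functional_extensionality; intros k. unfold q, upd.
    destruct (ix_dec k j), (ix_dec k i); congruence. }
  assert (q2 : forall u v v', q u v' = upd (q u v) j v').
  { intros u v u'. apply functional_extensionality; intros k. unfold q, upd.
    destruct (ix_dec k j), (ix_dec k i); congruence. }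
  assert (qi : forall u v, q u v i = u).
  { intros u v. unfold q. rewrite upd_neq, upd_eq; auto. }
  assert (qj : forall u v, q u v j = v).
  { intros u v. unfold q. now rewrite upd_eq. }
  assert (di : forall h u v, Derive (fun z => h (q z v)) u = pd i h (q u v)).
  { intros h u v. unfold pd. rewrite qi. apply Derive_ext. intros s.
    now rewrite (q1 u v s). }
  assert (dj : forall h u v, Derive (fun z => h (q u z)) v = pd j h (q u v)).
  { intros h u v. unfold pd. rewrite qj. apply Derive_ext. intros s.
    now rewrite (q2 u v s). }
  assert (exi : forall h u v, smooth U h -> U (q u v) ->
    ex_derive (fun z => h (q z v)) u).
  { intros h u v Hh Uq. generalize (smooth_ex_derive U h _ i Hh Uq).
    rewrite qi. apply ex_derive_ext. intros s. now rewrite (q1 u v s). }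
  assert (exj : forall h u v, smooth U h -> U (q u v) ->
    ex_derive (fun z => h (q u z)) v).
  { intros h u v Hh Uq. generalize (smooth_ex_derive U h _ j Hh Uq).
    rewrite qj. apply ex_derive_ext. intros s. now rewrite (q2 u v s). }
  assert (qx : q (x i) (x j) = x) by (unfold q; now rewrite !upd_id).
  assert (c2 : forall h, smooth U h ->
    continuity_2d_pt (fun u v => h (q u v)) (x i) (x j)).
  { intros h Hh eps.
    apply (cq (x i) (x j) (fun y => Rabs (h y - h (q (x i) (x j))) < eps)).
    rewrite qx. generalize (smooth_continuous U h x Hh Ux). intros c.
    apply (proj1 (filterlim_locally _ _) c eps). }
  assert (E := Schwarz (fun u v => f (q u v)) (x i) (x j)).
  cbv beta in E.
  assert (E1 : forall u v,
    Derive (fun z => Derive (fun t => f (q z t)) v) u = pd i (pd j f) (q u v)).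
  { intros u v. rewrite <- di. apply Derive_ext. intros z. apply dj. }
  assert (E2 : forall u v,
    Derive (fun z => Derive (fun t => f (q t z)) u) v = pd j (pd i f) (q u v)).
  { intros u v. rewrite <- dj. apply Derive_ext. intros z. apply di. }
  rewrite E1, E2, qx in E. apply E.
  - apply (locally_2d_impl_strong (fun u v => U (q u v))).
    + apply locally_2d_forall. intros u v H.
      apply locally_2d_singleton in H.
      repeat split; auto.
      * apply (ex_derive_ext (fun z => pd j f (q z v))); [intros; now rewrite dj |].
        apply exi; auto using smooth_pd.
      * apply (ex_derive_ext (fun z => pd i f (q u z))); [intros; now rewrite di |].
        apply exj; auto using smooth_pd.
    + apply cq. rewrite qx. now apply oU.
  - apply (continuity_2d_pt_ext (fun u v => pd i (pd j f) (q u v))); auto.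
    apply c2; auto using smooth_pd.
  - apply (continuity_2d_pt_ext (fun u v => pd j (pd i f) (q u v))); auto.
    apply c2; auto using smooth_pd.
Qed.
End Calculus.

(** * The Ricci tensor in adapted coordinates *)

(** The two mixed second derivatives of a function are different atoms for [field]; this identifies
    them. *)
Lemma eval_fD_comm (I : Type) (HI : Index I) (U : (I -> R) -> Prop) e i j x :
  open U -> wf U e -> U x -> eval (fD i (fD j e)) x = eval (fD j (fD i e)) x.
Proof.
  intros oU He Ux.
  assert (E : forall i j, eval (fD i (fD j e)) x = pd i (pd j (eval e)) x).
  { intros k l. rewrite <- (pd_eval U) by auto using wf_fD.
    apply (pd_ext_loc U); auto. intros y Uy. symmetry. now apply (pd_eval U). }
  rewrite !E. apply (pd_pd_comm U); auto using smooth_eval.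
Qed.

Lemma tpart_upd_inl (x : two + two -> R) i s :
  tpart (upd x (inl i) s) = upd (tpart x) i s.
Proof.
  apply functional_extensionality; intros j. unfold tpart, upd.
  now destruct i, j.
Qed.

Lemma tpart_upd_inr (x : two + two -> R) k s : tpart (upd x (inr k) s) = tpart x.
Proof.
  apply functional_extensionality; intros j. unfold tpart, upd. now destruct k.
Qed.

Lemma pd_tpart_inl (f : scalar two) i x :
  pd (inl i) (fun x => f (tpart x)) x = pd i f (tpart x).
Proof.
  unfold pd. apply Derive_ext. intros s. now rewrite tpart_upd_inl.
Qed.

Lemma pd_tpart_inr (f : scalar two) k x :
  pd (inr k) (fun x => f (tpart x)) x = 0.
Proof.
  unfold pd. rewrite (Derive_ext _ (fun _ => f (tpart x))).
  - apply Derive_const.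
  - intros s. now rewrite tpart_upd_inr.
Qed.

Lemma continuous_tpart x : continuous tpart x.
Proof.
  apply filterlim_locally; intros eps. exists eps; intros y Hy i. apply Hy.
Qed.

Lemma open_orbit_space U : open U -> open (orbit_space U).
Proof.
  intros oU t [x [Ux <-]]. destruct (oU x Ux) as [d Hd]. exists d.
  intros t Ht. exists (fun a => match a with inl i => t i | inr k => x (inr k) end).
  split; [apply Hd | easy]. intros [i | k]; [apply Ht | apply ball_center].
Qed.

Lemma orbit_space_tpart (U : (two + two -> R) -> Prop) x :
  U x -> orbit_space U (tpart x).
Proof. intros Ux. now exists x. Qed.

Lemma smooth_tpart U f : open U -> smooth (orbit_space U) f ->
  smooth U (fun x => f (tpart x)).
Proof.
  intros oU Hf.
  apply (smooth_coind U (fun g => exists f, smooth (orbit_space U) f /\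
    g = fun x => f (tpart x)) oU); [| | now exists f].
  - clear f Hf. intros g x [f [Hf ->]] Ux. assert (Dt := orbit_space_tpart U x Ux).
    split.
    + apply (continuous_comp tpart f); [apply continuous_tpart |].
      now apply (smooth_continuous (orbit_space U)).
    + intros [i | k].
      * generalize (smooth_ex_derive _ _ _ i Hf Dt). apply ex_derive_ext.
        intros s. now rewrite tpart_upd_inl.
      * apply (ex_derive_ext (fun _ => f (tpart x))); [| apply ex_derive_const].
        intros s. now rewrite tpart_upd_inr.
  - clear f Hf. intros g [i | k] [f [Hf ->]].
    + exists (fun x => pd i f (tpart x)). split.
      * exists (pd i f). split; [now apply smooth_pd | easy].
      * intros x _. apply pd_tpart_inl.
    + exists (fun _ => 0). split.
      * exists (fun _ => 0). split; [| easy].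
        apply smooth_const. now apply open_orbit_space.
      * intros x _. apply pd_tpart_inr.
Qed.

Section AdaptedRicci.
Context (U : (two + two -> R) -> Prop) (eps : R) (P p w : @fexp two)
  (a : two -> @fexp two) (g gi : tensor2 (two + two)).

(** Here [p], [w] and [a k] stand for h_11, h_12 and f_1^k; h_22 vanishes because d/dz_2 is null. *)
Definition hE (k l : two) : @fexp two :=
  match k, l with i1, i1 => p | i2, i2 => Zero | _, _ => w end.

Definition hiE (k l : two) : @fexp two :=
  match k, l with
  | i1, i1 => Zero
  | i2, i2 => Mul (Cst (-1)) (Mul p (Mul (Inv w) (Inv w)))
  | _, _ => Inv w
  end.

Definition uE : @fexp two := Exp (Mul (Cst (-2)) P).

Definition giE (i : two) : @fexp two :=
  match i with i1 => Inv uE | i2 => Mul (Cst (/ eps)) (Inv uE) end.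

Definition fE (i k : two) : @fexp two :=
  match i with i1 => a k | i2 => Zero end.

Definition sumE (F : two -> @fexp two) : @fexp two := Add (F i1) (F i2).

Definition GE (b c : two + two) : @fexp two :=
  match b, c with
  | inl i, inl j =>
      Add (match i, j with i1, i1 => uE | i2, i2 => Mul (Cst eps) uE | _, _ => Zero end)
        (sumE (fun k => sumE (fun l => Mul (Mul (hE k l) (fE i k)) (fE j l))))
  | inl i, inr l => sumE (fun k => Mul (hE k l) (fE i k))
  | inr k, inl j => sumE (fun l => Mul (hE k l) (fE j l))
  | inr k, inr l => hE k l
  end.

(** The Kaluza-Klein inverse: with the lifts e_i = d/dt_i - f_i^k d/dz_k, which are orthogonal to
    the leaves, it is gt^ij e_i e_j + h^kl d/dz_k d/dz_l, expanded in coordinates. *)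
Definition GIE (b c : two + two) : @fexp two :=
  match b, c with
  | inl i1, inl i1 => giE i1
  | inl i2, inl i2 => giE i2
  | inl i, inr l | inr l, inl i => Mul (Cst (-1)) (Mul (fE i l) (giE i))
  | inr k, inr l =>
     Add (hiE k l) (sumE (fun i => Mul (giE i) (Mul (fE i k) (fE i l))))
  | _, _ => Zero
  end.

(* F^k_ij = d_i f_j^k - d_j f_i^k, where f_2^k = 0. *)
Definition curvE (i j k : two) : @fexp two :=
  match i, j with
  | i1, i2 => Mul (Cst (-1)) (fD i2 (a k))
  | i2, i1 => fD i2 (a k)
  | _, _ => Zero
  end.

(* Gamma^m_ij of the orbit metric. *)
Definition orbitE (m i j : two) : @fexp two :=
  match m, i, j with
  | i1, i2, i2 => Mul (Cst eps) (fD i1 P)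
  | i2, i1, i1 => Mul (Cst (/ eps)) (fD i2 P)
  | i1, i1, i1 | i2, i1, i2 | i2, i2, i1 => Mul (Cst (-1)) (fD i1 P)
  | i2, i2, i2 | i1, i1, i2 | i1, i2, i1 => Mul (Cst (-1)) (fD i2 P)
  end.

(* The covariant derivatives of the coordinate fields are computed in the frame
   e_i = d/dt_i - f_i^k d/dz_k, d/dz_k (Kaluza-Klein): [SE], [TE], [horE] are
   coefficients of e_m, and [dhE], [verE] those of d/dz_n. *)
Definition SE (m k l : two) : @fexp two :=
  Mul (Cst (- / 2)) (Mul (giE m) (fD m (hE k l))).

Definition TE (m i k : two) : @fexp two :=
  Add (Mul (Cst (/ 2)) (Mul (giE m) (sumE (fun l => Mul (hE k l) (curvE i m l)))))
    (sumE (fun l => Mul (fE i l) (SE m l k))).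

Definition dhE (n i k : two) : @fexp two :=
  Mul (Cst (/ 2)) (sumE (fun m => Mul (hiE n m) (fD i (hE m k)))).

Definition horE (m : two) (b c : two + two) : @fexp two :=
  match b, c with
  | inl i, inl j =>
      Add (orbitE m i j)
        (Add (Mul (Cst (/ 2)) (Mul (giE m)
               (sumE (fun l => Mul (fE i l)
                 (sumE (fun k => Mul (hE l k) (curvE j m k)))))))
             (sumE (fun k => Mul (fE j k) (TE m i k))))
  | inl i, inr k | inr k, inl i => TE m i k
  | inr k, inr l => SE m k l
  end.

Definition verE (n : two) (b c : two + two) : @fexp two :=
  match b, c with
  | inl i, inl j =>
      Add (Add (Mul (Cst (- / 2)) (curvE i j n)) (fD i (fE j n)))
        (sumE (fun l => Add (Mul (fE i l) (dhE n j l)) (Mul (fE j l) (dhE n i l))))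
  | inl i, inr k | inr k, inl i => dhE n i k
  | inr k, inr l => Zero
  end.

Definition chrE (d b c : two + two) : @fexp two :=
  match d with
  | inl m => horE m b c
  | inr n => Add (verE n b c)
      (Mul (Cst (-1)) (sumE (fun m => Mul (fE m n) (horE m b c))))
  end.

Context (oU : open U).
Context (eps0 : eps <> 0).
Let O := orbit_space U.
Let oO : open O := open_orbit_space U oU.
Context (wP : wf O P).
Context (wp : wf O p).
Context (ww : wf O w).
Context (wa : forall k, wf O (a k)).
Context (w0 : forall t, O t -> eval w t <> 0).
Context (gE : forall b c x, U x -> g b c x = eval (GE b c) (tpart x)).
Context (gI : forall b c x, U x ->
  ix_sum (fun d => g b d x * gi d c x) = kron b c).

Lemma GI_left b c t : O t ->
  ix_sum (fun d => eval (GIE b d) t * eval (GE d c) t) = kron b c.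
Proof.
  intros Ot. assert (H := w0 t Ot). assert (He := exp_pos (-2 * eval P t)).
  assert (exp (-2 * eval P t) <> 0) by lra.
  destruct b as [[] | []], c as [[] | []]; cbn; field; auto.
Qed.

(** [gi] is given as a right inverse and [GIE] is a left inverse, so associativity makes them
    equal. *)
Lemma gi_eq b c x : U x -> gi b c x = eval (GIE b c) (tpart x).
Proof.
  intros Ux.
  assert (E : gi b c x = ix_sum (fun d => eval (GIE b d) (tpart x) *
    ix_sum (fun e => g d e x * gi e c x))).
  { transitivity (ix_sum (fun e => kron b e * gi e c x)).
    - destruct b as [[] | []], c as [[] | []]; cbn; ring.
    - cbn -[kron GIE GE].
      rewrite <- !(GI_left b _ _ (orbit_space_tpart U x Ux)).
      cbn -[kron GIE GE]. rewrite !gE by easy. ring. }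
  rewrite E. cbn -[kron GIE GE].
  assert (Q := fun d => gI d c x Ux). cbn -[kron] in Q. rewrite !Q.
  destruct b as [[] | []], c as [[] | []]; cbn -[GIE]; ring.
Qed.

Lemma wf_fE i k : wf O (fE i k).
Proof. destruct i; simpl; auto. Qed.

Lemma wf_hE k l : wf O (hE k l).
Proof. destruct k, l; simpl; auto. Qed.

Lemma wf_hiE k l : wf O (hiE k l).
Proof. destruct k, l; simpl; auto 10. Qed.

Lemma wf_curvE i j k : wf O (curvE i j k).
Proof. destruct i, j; simpl; auto using wf_fD. Qed.

Lemma wf_giE i : wf O (giE i).
Proof.
  assert (forall t, O t -> exp (-2 * eval P t) <> 0).
  { intros t _. generalize (exp_pos (-2 * eval P t)). lra. }
  destruct i; simpl; auto 10.
Qed.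

Lemma wf_GE b c : wf O (GE b c).
Proof.
  destruct b as [[] | []], c as [[] | []]; cbn; auto 20.
Qed.

Lemma wf_chrE d b c : wf O (chrE d b c).
Proof.
  assert (forall m i k, wf O (TE m i k)).
  { intros. cbn -[wf]. repeat split; auto using wf_fD, wf_fE, wf_hE, wf_curvE, wf_giE. }
  assert (forall n i k, wf O (dhE n i k)).
  { intros. repeat split; auto using wf_fD, wf_fE, wf_hE, wf_curvE, wf_hiE. }
  assert (Hh : forall n b c, wf O (horE n b c)).
  { intros n [i | k] [j | l]; repeat split;
    auto using wf_fD, wf_fE, wf_hE, wf_curvE, wf_hiE, wf_giE.
    destruct n, i, j; simpl; auto using wf_fD. }
  destruct d as [m | n]; [apply Hh |]. repeat split; auto using wf_fE.
  destruct b, c; repeat split; auto using wf_fD, wf_fE, wf_hE, wf_curvE, wf_hiE.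
Qed.

Lemma pd_lift (e : @fexp two) (f : scalar (two + two)) b x : wf O e ->
  (forall x, U x -> f x = eval e (tpart x)) -> U x ->
  pd b f x = match b with inl i => eval (fD i e) (tpart x) | inr _ => 0 end.
Proof.
  intros we fe Ux.
  rewrite (pd_ext_loc U f (fun x => eval e (tpart x))) by auto.
  destruct b as [i | k].
  - rewrite pd_tpart_inl. apply (pd_eval O); auto. now apply orbit_space_tpart.
  - apply pd_tpart_inr.
Qed.

(** The frame formulas need no derivation: each of the 64 components is compared with the definition
    by [field]. *)
Lemma christoffel_adapted d b c x : U x ->
  christoffel g gi d b c x = eval (chrE d b c) (tpart x).
Proof.
  intros Ux. unfold christoffel. cbn [ix_sum two_index sum_index].
  assert (Q := fun b c d => pd_lift (GE b c) (g b c) d x (wf_GE b c) (gE b c) Ux).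
  rewrite !Q, !gi_eq by easy. clear Q.
  assert (Ot := orbit_space_tpart U x Ux). set (t := tpart x) in *.
  assert (H := w0 t Ot). assert (He := exp_pos (-2 * eval P t)).
  assert (exp (-2 * eval P t) <> 0) by lra.
  destruct d as [[] | []], b as [[] | []], c as [[] | []]; cbn; field; auto.
Qed.

Definition dchrE (d e b c : two + two) : @fexp two :=
  match d with inl i => fD i (chrE e b c) | inr _ => Zero end.

Lemma ricci_adapted b c x : U x ->
  ricci g gi b c x =
  ix_sum (fun d => eval (simp (dchrE d d b c)) (tpart x)
      - eval (simp (dchrE c d b d)) (tpart x)
    + ix_sum (fun e =>
      eval (simp (chrE d d e)) (tpart x) * eval (simp (chrE e b c)) (tpart x)
      - eval (simp (chrE d c e)) (tpart x) * eval (simp (chrE e b d)) (tpart x))).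
Proof.
  intros Ux. unfold ricci.
  assert (Q : forall e d b c, pd e (christoffel g gi d b c) x =
    eval (dchrE e d b c) (tpart x)).
  { intros e d b' c'.
    rewrite (pd_lift (chrE d b' c')); auto using wf_chrE, christoffel_adapted.
    now destruct e. }
  cbn [ix_sum two_index sum_index].
  rewrite !Q, !christoffel_adapted, !eval_simp by easy. reflexivity.
Qed.

Ltac ricci_field Ux :=
  rewrite !(ricci_adapted _ _ _ Ux);
  cbn [ix_sum two_index sum_index]; rewrite ?eval_simp;
  match type of Ux with _ ?x =>
    let Ot := fresh "Ot" in let H := fresh in
    assert (Ot := orbit_space_tpart U x Ux); fold O in Ot;
    generalize dependent (tpart x); intros t Ot;
    assert (H := w0 t Ot);
    assert (exp (-2 * eval P t) <> 0)
      by (generalize (exp_pos (-2 * eval P t)); lra)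
  end.

(** All terms with derivatives of h contain h_22 or h^11, which vanish. What is left is the square
    of the curvature 2-form paired with d/dz_2, and h_2l F^l = h_12 F^1. *)
Lemma ricci_22 x : U x ->
  ricci g gi (inr i2) (inr i2) x =
  / (2 * eps) * (eval w (tpart x) * eval (fD i2 (a i1)) (tpart x)
                / eval uE (tpart x)) ^ 2.
Proof.
  intros Ux. ricci_field Ux. cbn -[pow]. field; auto.
Qed.

(* h_12 h_kl C^l; as det h = - h_12^2, its derivatives are the divergence of the
   curvature two-form. *)
Definition momE (k : two) : @fexp two :=
  Mul w (Mul (sumE (fun l => Mul (hE k l) (fD i2 (a l)))) (Inv uE)).

(** The left-hand side is Ric(e_i, d/dz_k) for the lift e_i. On a two-dimensional orbit space a
    2-form is a scalar times the area form, and its divergence is the rotated gradient of that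
    scalar; hence t_1 and t_2 are exchanged on the right. *)
Lemma ricci_hor_ver i k x : U x ->
  ricci g gi (inl i) (inr k) x
    - ix_sum (fun l => eval (fE i l) (tpart x) * ricci g gi (inr l) (inr k) x) =
  match i with
  | i1 => - / (2 * eps * eval w (tpart x)) * eval (fD i2 (momE k)) (tpart x)
  | i2 => / (2 * eval w (tpart x)) * eval (fD i1 (momE k)) (tpart x)
  end.
Proof.
  intros Ux. cbn [ix_sum two_index]. ricci_field Ux.
  assert (C := fun e we => eval_fD_comm two _ O e i1 i2 t oO we Ot).
  destruct i, k; cbn; rewrite ?(C _ (wa _)), ?(C _ ww), ?(C _ wp), ?(C _ wP);
    field; auto.
Qed.
End AdaptedRicci.

(** * The full Ricci tensor for a constant leaf metric and a constant null curvature field *)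

Section FlatLeaves.
Context (U : (two + two -> R) -> Prop) (eps w r k : R) (P : scalar two)
  (a : two -> scalar two) (g gi : tensor2 (two + two)).
Context (oU : open U) (eps0 : eps <> 0) (w0 : w <> 0).
Let O := orbit_space U.
Context (sP : smooth O P) (sa : forall k, smooth O (a k)).
Context (gE : forall b c x, U x ->
  g b c x = eval (GE eps (Fn P) (Cst (- 2 * w * r)) (Cst w) (fun k => Fn (a k)) b c)
    (tpart x)).
Context (gI : forall b c x, U x ->
  ix_sum (fun d => g b d x * gi d c x) = kron b c).
Context (da1 : forall t, O t -> pd i2 (a i1) t = k * exp (- 2 * P t)).
Context (da2 : forall t, O t -> pd i2 (a i2) t = r * k * exp (- 2 * P t)).

(** The 1-form g(C, .) in the coordinate basis, for the curvature field C = k (d/dz_1 + r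
    d/dz_2). *)
Definition curv_form (b : two + two) (t : two -> R) : R :=
  match b with
  | inl i1 => w * k * (a i2 t - r * a i1 t)
  | inl i2 => 0
  | inr i1 => - (w * r * k)
  | inr i2 => w * k
  end.

(** With h and C constant, the derivatives of h and the divergence of the curvature form drop out.
    The contribution of C along the orbit space is proportional to g(C,C), which vanishes as h_11 =
    -2 w r. There remain the Ricci tensor of the orbit metric and the square of g(C, .). *)
Lemma ricci_flat b c x : U x ->
  ricci g gi b c x =
  match b, c with
  | inl i1, inl i1 => pd i1 (pd i1 P) (tpart x) + / eps * pd i2 (pd i2 P) (tpart x)
  | inl i2, inl i2 => eps * pd i1 (pd i1 P) (tpart x) + pd i2 (pd i2 P) (tpart x)
  | _, _ => 0
  end + / (2 * eps) * curv_form b (tpart x) * curv_form c (tpart x).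
Proof.
  intros Ux.
  rewrite (ricci_adapted U eps (Fn P) (Cst (- 2 * w * r)) (Cst w)
    (fun k => Fn (a k)) g gi oU eps0 sP Logic.I Logic.I sa (fun _ _ => w0) gE gI)
    by easy.
  assert (Ot := orbit_space_tpart U x Ux). fold O in Ot. clear Ux.
  generalize dependent (tpart x). clear x. intros t Ot.
  assert (oO := open_orbit_space U oU). fold O in oO.
  assert (C := fun f sf => pd_pd_comm O f i2 i1 t oO sf Ot).
  assert (dda : forall i, pd i (fun t => exp (- 2 * P t)) t =
    - 2 * pd i P t * exp (- 2 * P t)).
  { intros i. rewrite (pd_eval O (Exp (Mul (Cst (-2)) (Fn P)))); cbn; auto. ring. }
  assert (dda1 : forall i, pd i (pd i2 (a i1)) t =
    k * (- 2 * pd i P t * exp (- 2 * P t))).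
  { intros i. rewrite (pd_ext_loc O _ (eval (Mul (Cst k) (Exp (Mul (Cst (-2)) (Fn P)))))),
      (pd_eval O); cbn; auto. ring. }
  assert (dda2 : forall i, pd i (pd i2 (a i2)) t =
    r * k * (- 2 * pd i P t * exp (- 2 * P t))).
  { intros i. rewrite (pd_ext_loc O _
      (eval (Mul (Cst (r * k)) (Exp (Mul (Cst (-2)) (Fn P)))))),
      (pd_eval O); cbn; auto. ring. }
  assert (He := exp_pos (- 2 * P t)).
  destruct b as [[] | []], c as [[] | []]; cbn -[Rdiv];
    rewrite ?(C _ sP), ?(C _ (sa _)), ?dda1, ?dda2, ?da1, ?da2 by easy;
    field; repeat split; auto; lra.
Qed.
End FlatLeaves.

(** * The orbit metric and its curvature equation *)

Section OrbitMetric.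
Context (O : (two -> R) -> Prop) (eps : R) (P : scalar two).
Context (oO : open O) (eps0 : eps <> 0) (sP : smooth O P).

Definition conf_inv : tensor2 two := fun i j t => match i, j with
  | i1, i1 => / exp (- 2 * P t)
  | i2, i2 => / (eps * exp (- 2 * P t))
  | _, _ => 0
  end.

Definition confE (i j : two) : @fexp two := match i, j with
  | i1, i1 => Exp (Mul (Cst (- 2)) (Fn P))
  | i2, i2 => Mul (Cst eps) (Exp (Mul (Cst (- 2)) (Fn P)))
  | _, _ => Zero
  end.

Lemma wf_confE i j : wf O (confE i j).
Proof. destruct i, j; simpl; auto. Qed.

Lemma conformal_metric_pseudo : pseudo_metric O (conformal_metric eps P) conf_inv.
Proof.
  split.
  - intros i j. apply (smooth_ext O (eval (confE i j))); [easy | |].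
    + intros t _. now destruct i, j.
    + apply smooth_eval; [easy | apply wf_confE].
  - intros i j t _. now destruct i, j.
  - intros i k t _. generalize (exp_pos (- 2 * P t)). intros He.
    destruct i, k; cbn; field; repeat split; auto; lra.
Qed.

Lemma christoffel_conformal k i j t : O t ->
  christoffel (conformal_metric eps P) conf_inv k i j t =
  eval (orbitE eps (Fn P) k i j) t.
Proof.
  intros Ot. unfold christoffel.
  assert (Q : forall k i j, pd k (conformal_metric eps P i j) t =
    eval (fD k (confE i j)) t).
  { intros m b c. rewrite <- (pd_eval O) by auto using wf_confE.
    apply pd_ext. intros s. now destruct b, c. }
  cbn [ix_sum two_index]. rewrite !Q.
  generalize (exp_pos (- 2 * P t)); intros He.
  destruct k, i, j; cbn; field; repeat split; auto; lra.
Qed.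

Lemma gauss_conformal K :
  (forall t, O t -> pd i1 (pd i1 P) t + / eps * pd i2 (pd i2 P) t
     = K t * exp (- 2 * P t)) ->
  gauss_curvature O (conformal_metric eps P) K.
Proof.
  intros HK. exists conf_inv. split; [apply conformal_metric_pseudo |].
  intros i j t Ot. unfold ricci.
  assert (Q : forall e k i j,
    pd e (christoffel (conformal_metric eps P) conf_inv k i j) t =
    eval (fD e (orbitE eps (Fn P) k i j)) t).
  { intros e k b c.
    rewrite (pd_ext_loc O _ (eval (orbitE eps (Fn P) k b c)));
      auto using christoffel_conformal.
    apply (pd_eval O); [| easy].
    destruct k, b, c; simpl; auto using smooth_pd. }
  cbn [ix_sum two_index]. rewrite !Q, !christoffel_conformal by easy.
  assert (C := pd_pd_comm O P i1 i2 t oO sP Ot).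
  specialize (HK t Ot).
  destruct i, j; cbn; rewrite ?C; rewrite <- ?HK; try (field; auto).
  transitivity (eps * (K t * exp (- 2 * P t))); [| ring].
  rewrite <- HK. field; auto.
Qed.
End OrbitMetric.

(* [P = ln (e^t + Lambda / 4 * e^-t)] in [t = t_1]: for [R = e^P] the equation
   reads [R R'' - R'^2 = Lambda], which is [4 A B = Lambda] for
   [R = A e^t + B e^-t]. *)
Lemma soliton_data_exists eps Lambda :
  exists (W : (two + two -> R) -> Prop) (P F : scalar two),
    open W /\ (exists x, W x) /\ soliton_data (orbit_space W) eps Lambda P F.
Proof.
  set (e1 := Exp (Fn (fun t : two -> R => t i1))).
  set (e2 := Exp (Mul (Cst (-1)) (Fn (fun t : two -> R => t i1)))).
  set (r := Add e1 (Mul (Cst (Lambda / 4)) e2)).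
  assert (wr : forall O, open O -> wf O r).
  { intros O oO. assert (H := smooth_coord O (i1 : two) oO). simpl. tauto. }
  set (O := fun t : two -> R => 0 < eval r t).
  assert (oO : open O).
  { intros t Ot.
    assert (oT : open (fun _ : two -> R => True)) by apply open_true.
    apply (proj1 (eval_correct _ r t (wr _ oT) Logic.I) (fun y => 0 < y)).
    now apply (open_gt 0). }
  set (W := fun x : two + two -> R => O (tpart x)).
  assert (oW : open W).
  { intros x Wx. apply (continuous_tpart x O). now apply oO. }
  assert (WO : forall t, orbit_space W t -> O t) by now intros t [x [Wx <-]].
  set (P := fun t => ln (eval r t)).
  assert (nr : forall t, O t -> eval r t <> 0) by (unfold O; intros t Ot; lra).
  set (q := fun i => Mul (fD i r) (Inv r)).
  assert (wq : forall i, wf O (q i)).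
  { intros i. split; [now apply wf_fD, wr | now split; [apply wr |]]. }
  assert (dP : forall i t, O t ->
    is_derive (fun s => P (upd t i s)) (t i) (eval (q i) t)).
  { intros i t Ot. apply (is_derive_comp ln (fun s => eval r (upd t i s))).
    - rewrite upd_id. now apply is_derive_ln.
    - now apply (eval_correct O r t (wr O oO)). }
  assert (pP : forall i t, O t -> pd i P t = eval (q i) t).
  { intros i t Ot. now apply is_derive_unique, dP. }
  assert (sP : smooth O P).
  { apply smooth_of_pd; [easy | |].
    - intros t Ot. split; [| intros i; eexists; now apply dP].
      apply (continuous_comp (eval r) ln).
      + now apply (eval_correct O r t (wr O oO)).
      + apply (@ex_derive_continuous R_AbsRing R_NormedModule).
        eexists. now apply is_derive_ln.
    - intros i. exists (eval (q i)). split; [now apply smooth_eval | auto]. }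
  assert (eP : forall t, O t -> exp (- 2 * P t) = / (eval r t * eval r t)).
  { intros t Ot. unfold P. replace (- 2 * ln (eval r t))
      with (- (ln (eval r t) + ln (eval r t))) by ring.
    now rewrite exp_Ropp, exp_plus, exp_ln. }
  (* [P] depends on t_1 only, so t_2 e^{-2P} is an antiderivative. *)
  set (F := Mul (Fn (fun t : two -> R => t i2)) (Mul (Inv r) (Inv r))).
  assert (wF : wf O F) by (cbn [wf F]; auto 10 using smooth_coord).
  assert (dd : forall i j k (t : two -> R), pd j (pd i (fun t => t k)) t = 0).
  { intros i j k t. rewrite (pd_ext _ (fun _ => kron i k)) by apply pd_coord.
    apply pd_const. }
  exists W, P, (eval F). split; [easy |]. split; [| split].
  (* At t_1 = |Lambda| the function [r] is positive: e^|Lambda| >= 1 + |Lambda|, while the other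
     term is at least - |Lambda| / 4. *)
  - exists (fun _ => Rabs Lambda). unfold W, O, tpart. cbn.
    generalize (exp_ineq1_le (Rabs Lambda)), (exp_pos (-1 * Rabs Lambda)).
    intros H1 H2.
    assert (H3 : exp (-1 * Rabs Lambda) <= 1).
    { assert (E : exp (-1 * Rabs Lambda) * exp (Rabs Lambda) = 1).
      { rewrite <- exp_plus, <- exp_0. f_equal. ring. }
      generalize (Rabs_pos Lambda). nra. }
    generalize (Rle_abs (- Lambda)). rewrite Rabs_Ropp. generalize (Rabs_pos Lambda).
    intros; nra.
  - now apply (smooth_mono O).
  - apply (smooth_mono O); auto using smooth_eval.
  - intros t Wt. assert (Ot := WO t Wt). rewrite (pd_eval O), eP by easy.
    assert (N := nr t Ot). revert N. cbn. rewrite !pd_coord. cbn. intros N.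
    field. intros Z. apply N. lra.
  - intros t Wt. assert (Ot := WO t Wt).
    rewrite !(pd_ext_loc O (pd _ P) (eval (q _))), eP, !(pd_eval O) by auto.
    assert (N := nr t Ot). revert N. cbn. rewrite !dd, !pd_coord. cbn. intros N.
    assert (E : exp (-1 * t i1) = / exp (t i1)).
    { rewrite <- exp_Ropp. f_equal. ring. }
    rewrite E in *. generalize (exp_pos (t i1)); intros X.
    field. split; [lra |]. intros Z. apply N.
    apply (Rmult_eq_reg_r (4 * exp (t i1))); [| lra].
    rewrite Rmult_0_l, <- Z. field. lra.
Qed.

(** * The metrics of the stated form are solitons *)

Lemma pd_affine (I : Type) (HI : Index I) (u v w : R) (j k i : I) x :
  pd i (fun x => u * x j + v * x k + w) x = u * kron i j + v * kron i k.
Proof.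
  rewrite <- !(fun j => pd_coord i j x).
  assert (oT : open (fun _ : I -> R => True)) by apply open_true.
  set (e := Add (Add (Mul (Cst u) (Fn (fun x => x j))) (Mul (Cst v) (Fn (fun x => x k))))
    (Cst w)).
  assert (we : wf (fun _ => True) e) by (simpl; auto 10 using smooth_coord).
  rewrite (pd_ext _ (eval e)) by easy. rewrite (pd_eval (fun _ => True)) by easy.
  cbn. ring.
Qed.

Section Converse.
Context (W : (two + two -> R) -> Prop) (eps Lambda c a1 a2 : R)
  (P F : scalar two).
Context (oW : open W) (Heps : eps = 1 \/ eps = -1).
Let O := orbit_space W.
Context (data : soliton_data O eps Lambda P F).

(** The vector (F, cF) solves h_kl f_1^k = g(d/dt_1, d/dz_l). It is null for the leaf metric, so the
    adapted form has no additional dt_1^2 term. *)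
Definition sol_a (k : two) : scalar two :=
  match k with i1 => F | i2 => fun t => c * F t end.

Definition sol_f (i k : two) : scalar two :=
  match i with i1 => sol_a k | i2 => fun _ => 0 end.

Definition sol_h (k l : two) : scalar two := fun _ =>
  match k, l with i1, i1 => - 2 * c | i2, i2 => 0 | _, _ => 1 end.

Definition sol_gi : tensor2 (two + two) := fun b d x =>
  eval (GIE eps (Fn P) (Cst (- 2 * 1 * c)) (Cst 1) (fun k => Fn (sol_a k)) b d) (tpart x).

Let g := soliton_metric eps c P F.
Let X := soliton_field eps Lambda c a1 a2.

Lemma eps_neq0 : eps <> 0.
Proof. destruct Heps; lra. Qed.

Lemma oO : open O.
Proof. now apply open_orbit_space. Qed.

Lemma sol_gE b d x :
  g b d x = eval (GE eps (Fn P) (Cst (- 2 * 1 * c)) (Cst 1) (fun k => Fn (sol_a k)) b d)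
    (tpart x).
Proof. destruct b as [[] | []], d as [[] | []]; cbn; ring. Qed.

Lemma smooth_sol_a k : smooth O (sol_a k).
Proof.
  destruct k; simpl; [apply data |].
  apply (smooth_eval O (Mul (Cst c) (Fn F)) oO). simpl. split; [easy | apply data].
Qed.

Lemma wf_sol b d :
  wf O (GE eps (Fn P) (Cst (- 2 * 1 * c)) (Cst 1) (fun k => Fn (sol_a k)) b d).
Proof.
  assert (H := smooth_sol_a). assert (H' := sd_P data).
  apply wf_GE; simpl; auto.
Qed.

Lemma sol_inv b d x :
  ix_sum (fun e => g b e x * sol_gi e d x) = kron b d.
Proof.
  assert (He := exp_pos (- 2 * P (tpart x))). assert (H := eps_neq0).
  destruct b as [[] | []], d as [[] | []]; cbn; field; repeat split; auto; lra.
Qed.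

Lemma sol_metric : pseudo_metric W g sol_gi.
Proof.
  split.
  - intros b d. apply (smooth_ext W (fun x => eval (GE eps (Fn P) (Cst (- 2 * 1 * c)) (Cst 1)
      (fun k => Fn (sol_a k)) b d) (tpart x))); [easy | |].
    + intros x _. now rewrite sol_gE.
    + apply smooth_tpart; [easy |]. apply smooth_eval; [apply oO | apply wf_sol].
  - intros b d x _. now destruct b as [[] | []], d as [[] | []].
  - intros b d x _. apply sol_inv.
Qed.

Lemma pd_sol_inr b d k x : pd (inr k) (g b d) x = 0.
Proof.
  rewrite (pd_ext _ _ (sol_gE b d)). apply pd_tpart_inr.
Qed.

Lemma smooth_sol_field : smooth_vfield W X.
Proof.
  assert (H : forall u v w, smooth W (fun x => u * x (inr i1) + v * x (inr i2) + w)).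
  { intros u v w.
    apply (smooth_eval W (Add (Add (Mul (Cst u) (Fn (fun x => x (inr i1))))
      (Mul (Cst v) (Fn (fun x => x (inr i2))))) (Cst w)) oW).
    simpl; auto 10 using smooth_coord. }
  intros [i | []]; simpl.
  - apply (smooth_const W 0 oW).
  - apply (smooth_ext W (fun x => eps * c / 2 * x (inr i1) + - (eps / 2) * x (inr i2) + a1));
      auto. intros x _. unfold X; simpl; field.
  - apply H.
Qed.

Definition sol_X (k l : two) : R :=
  match k, l with
  | i1, i1 => eps * c / 2
  | i1, i2 => - (eps / 2)
  | i2, i1 => eps * c ^ 2 / 2 - 2 * Lambda * c
  | i2, i2 => 2 * Lambda - eps * c / 2
  end.

Lemma pd_sol_field b d x :
  pd b (X d) x = match d, b with inr k, inr l => sol_X k l | _, _ => 0 end.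
Proof.
  destruct d as [i | k].
  { transitivity (pd b (fun _ => 0) x); [easy |]. rewrite pd_const. now destruct b. }
  rewrite (pd_ext _ (fun x => sol_X k i1 * x (inr i1) + sol_X k i2 * x (inr i2)
    + match k with i1 => a1 | i2 => a2 end)).
  - rewrite pd_affine. destruct b as [i | []]; cbn; destruct k; cbn; ring.
  - intros y. unfold X. destruct k; cbn; field.
Qed.

Lemma sol_soliton : ricci_soliton W g sol_gi X Lambda.
Proof.
  split; [apply smooth_sol_field |].
  intros b d x Wx. unfold lie_tensor2.
  assert (dF := sd_antiderivative data).
  (* The stated metric has w = 1 and r = c; k = 1 because F is an antiderivative of e^{-2P}
     itself. *)
  rewrite (ricci_flat W eps 1 c 1 P sol_a g sol_gi oW eps_neq0 R1_neq_R0
    (sd_P data) smooth_sol_a); auto.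
  - cbn [ix_sum two_index sum_index]. rewrite !pd_sol_inr, !pd_sol_field.
    assert (E := sd_pde data (tpart x) (orbit_space_tpart W x Wx)).
    assert (E1 : / eps = eps) by (destruct Heps as [-> | ->]; field).
    assert (E2 : / (2 * eps) = eps / 2) by (destruct Heps as [-> | ->]; field).
    rewrite E1, E2. subst g X.
    assert (E3 : eps * pd i1 (pd i1 P) (tpart x) + pd i2 (pd i2 P) (tpart x)
      = Lambda * (eps * exp (-2 * P (tpart x)))).
    { transitivity (eps * (Lambda * exp (-2 * P (tpart x)))); [| ring].
      rewrite <- E. destruct Heps as [-> | ->]; ring. }
    destruct b as [[] | []], d as [[] | []]; cbn -[pow]; rewrite ?E, ?E3; try field.
  - intros; apply sol_gE.
  - intros; apply sol_inv.
  - intros t Ot. transitivity (pd i2 F t); [easy |]. rewrite (dF t Ot). ring.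
  - intros t Ot. transitivity (pd i2 (eval (Mul (Cst c) (Fn F))) t); [easy |].
    rewrite (pd_eval O (Mul (Cst c) (Fn F)) i2 t (conj Logic.I (sd_F data)) Ot). simpl.
    rewrite (dF t Ot). ring.
Qed.

Let xi (k : two) : vfield (two + two) := coord_field (inr k).

Lemma sol_inner_xi Y k x : inner g Y (xi k) x =
  match k with
  | i1 => - c * F (tpart x) * Y (inl i1) x - 2 * c * Y (inr i1) x + Y (inr i2) x
  | i2 => F (tpart x) * Y (inl i1) x + Y (inr i1) x
  end.
Proof. destruct k; cbn; ring. Qed.

Lemma sol_killing : abelian_killing_algebra W g xi.
Proof.
  split; [| split].
  - intros k. split.
    + intros b. apply (smooth_const W (kron (inr k) b) oW).
    + intros b d x _. unfold lie_tensor2, xi, coord_field. cbn [ix_sum two_index sum_index].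
      rewrite !pd_const, !pd_sol_inr. destruct k; cbn; ring.
  - intros b x _. unfold bracket, xi, coord_field. cbn [ix_sum two_index sum_index].
    rewrite !pd_const. ring.
  - intros x _ u Hu k.
    generalize (Hu (inr i1)), (Hu (inr i2)). cbn. destruct k; lra.
Qed.

(** The vertical part of every field orthogonal to the leaves is a multiple of d/dz_1 + c d/dz_2,
    and the linear part of [X] annihilates this direction. *)
Lemma sol_symmetry : symmetry_of_orth W g xi X.
Proof.
  intros Y [sY oY].
  assert (sX := smooth_sol_field).
  assert (Y1 : forall x, W x -> Y (inr i1) x = - F (tpart x) * Y (inl i1) x).
  { intros x Wx. generalize (oY i2 x Wx). rewrite sol_inner_xi. lra. }
  assert (Y2 : forall x, W x -> Y (inr i2) x = - (c * F (tpart x)) * Y (inl i1) x).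
  { intros x Wx. generalize (oY i1 x Wx). rewrite sol_inner_xi, Y1 by easy. lra. }
  split.
  - intros b.
    apply (smooth_ext W (eval
      (Add (Add (Add (Mul (Fn (X (inl i1))) (Fn (pd (inl i1) (Y b))))
        (Mul (Cst (-1)) (Mul (Fn (Y (inl i1))) (Fn (pd (inl i1) (X b))))))
        (Add (Mul (Fn (X (inl i2))) (Fn (pd (inl i2) (Y b))))
        (Mul (Cst (-1)) (Mul (Fn (Y (inl i2))) (Fn (pd (inl i2) (X b)))))))
        (Add (Add (Mul (Fn (X (inr i1))) (Fn (pd (inr i1) (Y b))))
        (Mul (Cst (-1)) (Mul (Fn (Y (inr i1))) (Fn (pd (inr i1) (X b))))))
        (Add (Mul (Fn (X (inr i2))) (Fn (pd (inr i2) (Y b))))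
        (Mul (Cst (-1)) (Mul (Fn (Y (inr i2))) (Fn (pd (inr i2) (X b)))))))))).
    + easy.
    + intros y _. unfold bracket. cbn [ix_sum two_index sum_index]. simpl. ring.
    + apply smooth_eval; [easy |].
      simpl. repeat match goal with |- _ /\ _ => split end; auto using smooth_pd.
  - intros k x Wx. rewrite sol_inner_xi. unfold bracket.
    cbn [ix_sum two_index sum_index]. rewrite !pd_sol_field.
    (* The factors in [Y1] and [Y2] depend on t only, so these relations persist under
       differentiation in z_l. *)
    assert (dY : forall (e : @fexp two) b l, wf O e ->
      (forall x, W x -> Y b x = eval e (tpart x) * Y (inl i1) x) ->
      pd (inr l) (Y b) x = eval e (tpart x) * pd (inr l) (Y (inl i1)) x).
    { intros e b l we Hb.
      rewrite (pd_ext_loc W _ (eval (Mul (Fn (fun x => eval e (tpart x))) (Fn (Y (inl i1)))))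
        oW Hb) by easy.
      rewrite (pd_eval W).
      - simpl. rewrite pd_tpart_inr. ring.
      - simpl. split; auto. apply smooth_tpart; auto. apply smooth_eval; auto.
        apply oO.
      - easy. }
    assert (sF := sd_F data).
    assert (E1 := fun l => dY (Mul (Cst (-1)) (Fn F)) (inr i1) l (conj Logic.I sF)).
    assert (E2 := fun l => dY (Mul (Cst (- c)) (Fn F)) (inr i2) l (conj Logic.I sF)).
    simpl in E1, E2.
    rewrite !E1, !E2, Y1, Y2; auto.
    + unfold X. destruct k; cbn; field.
    + intros y Wy. rewrite Y2 by easy. ring.
    + intros y Wy. rewrite Y2 by easy. ring.
    + intros y Wy. rewrite Y1 by easy. ring.
    + intros y Wy. rewrite Y1 by easy. ring.
Qed.

Lemma sol_null_killing_soliton :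
  null_killing_soliton W g sol_gi xi (conformal_metric eps P) sol_h sol_f X Lambda.
Proof.
  assert (oO' := oO).
  assert (dF := sd_antiderivative data).
  (* C is a multiple of d/dz_1 + c d/dz_2, which is null. *)
  assert (Hc : forall t, curvature_coef (conformal_metric eps P) sol_f i1 t
      = pd i2 F t / sqrt (Rabs (det2 (fun i j => conformal_metric eps P i j t))) /\
     (O t -> curvature_coef (conformal_metric eps P) sol_f i2 t
      = c * curvature_coef (conformal_metric eps P) sol_f i1 t)).
  { intros t. assert (E1 : curvature_coef (conformal_metric eps P) sol_f i1 t
      = pd i2 F t / sqrt (Rabs (det2 (fun i j => conformal_metric eps P i j t)))).
    { unfold curvature_coef, sol_f, sol_a. rewrite pd_const. now rewrite Rminus_0_r. }
    split; [easy |]. intros Ot. rewrite E1.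
    unfold curvature_coef, sol_f, sol_a. rewrite pd_const.
    change (fun t => c * F t) with (eval (Mul (Cst c) (Fn F))).
    rewrite (pd_eval O (Mul (Cst c) (Fn F)) i2 t (conj Logic.I (sd_F data)) Ot). simpl.
    unfold Rdiv. ring. }
  split.
  - easy.
  - apply sol_metric.
  - apply sol_killing.
  - intros x _. unfold det2. cbn. lra.
  - easy.
  - intros i j. split; [| split].
    + apply (conformal_metric_pseudo O eps P oO' eps_neq0 (sd_P data)).
    + apply (smooth_const O (match i, j with
        | i1, i1 => - 2 * c | i2, i2 => 0 | _, _ => 1 end) oO').
    + destruct i; [apply smooth_sol_a | apply (smooth_const O 0 oO')].
  - intros b d x _. destruct b as [[] | []], d as [[] | []]; cbn; ring.
  - intros x Wx. exists (inr i1). simpl. destruct (Hc (tpart x)) as [-> _].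
    rewrite dF by now apply orbit_space_tpart.
    apply Rmult_integral_contrapositive_currified.
    + generalize (exp_pos (- 2 * P (tpart x))). lra.
    + apply Rinv_neq_0_compat. intros H. apply sqrt_eq_0 in H; [| apply Rabs_pos].
      revert H. apply Rabs_no_R0. unfold det2. simpl.
      rewrite Rmult_0_l, Rminus_0_r.
      generalize (exp_pos (- 2 * P (tpart x))), eps_neq0. intros He H.
      repeat apply Rmult_integral_contrapositive_currified; lra.
  - apply sol_soliton.
  - intros x Wx. destruct (Hc (tpart x)) as [_ H2].
    specialize (H2 (orbit_space_tpart W x Wx)).
    unfold inner, curvature_field. cbn [ix_sum two_index sum_index].
    rewrite H2. cbn. ring.
  - exists (fun k => match k with i1 => 0 | i2 => 1 end). split.
    + exists i2. lra.
    + intros x _. cbn. ring.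
  - intros x _. exists (fun k => X (inr k) x). intros [i | []]; cbn; ring.
  - apply sol_symmetry.
Qed.

Lemma sol_normal_form :
  normal_form O eps P (conformal_metric eps P) sol_h sol_f.
Proof.
  assert (dF := sd_antiderivative data).
  split; try easy.
  - apply data.
  - intros t _. simpl. lra.
  - intros t Ot. cbn [sol_f sol_a]. rewrite dF by easy.
    generalize (exp_pos (- 2 * P t)) (pow2_ge_0 (pd i2 (fun t => c * F t) t)).
    intros; nra.
Qed.
End Converse.

(** * Functions with vanishing derivatives on a box *)

Lemma ball_upd (I : Type) (HI : Index I) (x0 x : I -> R) (d : R) i s :
  ball x0 d x -> ball (x0 i) d s -> ball x0 d (upd x i s).
Proof.
  intros Hx Hs j. unfold upd. destruct (ix_dec j i) as [-> |]; [easy | apply Hx].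
Qed.

(** A ball of the supremum uniform structure is a box, so the coordinate segment from [x] to
    [upd x i s] stays inside it and the one-variable theorem applies. *)
Lemma box_step (I : Type) (HI : Index I) (U : (I -> R) -> Prop) (x0 : I -> R)
  (d : R) (f : scalar I) i x s :
  (forall y, ball x0 d y -> U y) -> smooth U f ->
  (forall y, ball x0 d y -> pd i f y = 0) ->
  ball x0 d x -> ball (x0 i) d s -> f (upd x i s) = f x.
Proof.
  intros BU sf df Bx Bs.
  assert (D : forall s', ball (x0 i) d s' ->
    is_derive (fun s => f (upd x i s)) s' 0).
  { intros s' Bs'. assert (By := ball_upd _ _ _ _ _ i s' Bx Bs').
    rewrite <- (df _ By). unfold pd. rewrite upd_eq.
    rewrite (Derive_ext _ (fun s => f (upd x i s))).
    - apply Derive_correct.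
      generalize (smooth_ex_derive U f _ i sf (BU _ By)). rewrite upd_eq.
      apply ex_derive_ext. intros z. f_equal.
      apply functional_extensionality; intros j. unfold upd. now destruct (ix_dec j i).
    - intros z. f_equal.
      apply functional_extensionality; intros j. unfold upd. now destruct (ix_dec j i). }
  assert (Bi := Bx i).
  assert (C : forall a b, ball (x0 i) d a -> ball (x0 i) d b -> a < b ->
    f (upd x i a) = f (upd x i b)).
  { intros a b Ba Bb ab. apply (eq_is_derive (fun s => f (upd x i s))); [| easy].
    intros s' Hs'. apply D. revert Ba Bb.
    unfold ball; simpl; unfold AbsRing_ball, abs, minus, plus, opp; simpl.
    intros [H1 H2]%Rabs_def2 [H3 H4]%Rabs_def2. apply Rabs_def1; lra. }
  rewrite <- (upd_id x i) at 2.
  destruct (Rtotal_order s (x i)) as [H | [-> | H]]; [now apply C | easy |].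
  symmetry. now apply C.
Qed.

Lemma box_const2 (U : (two -> R) -> Prop) (t0 : two -> R) (d : posreal) f t :
  (forall y, ball t0 d y -> U y) -> smooth U f ->
  (forall i y, ball t0 d y -> pd i f y = 0) -> ball t0 d t -> f t = f t0.
Proof.
  intros BU sf df Bt.
  assert (S := fun i x s => box_step _ _ U t0 d f i x s BU sf (df i)).
  assert (B0 := ball_center t0 d). assert (B1 := ball_upd _ _ t0 t0 d i1 _ B0 (Bt i1)).
  rewrite <- (S i1 t0 (t i1)), <- (S i2 _ (t i2) B1) by auto.
  f_equal. apply functional_extensionality; intros []; reflexivity.
Qed.

Lemma box_const4 (U : (two + two -> R) -> Prop) (x0 : two + two -> R) (d : posreal) f x :
  (forall y, ball x0 d y -> U y) -> smooth U f ->
  (forall i y, ball x0 d y -> pd i f y = 0) -> ball x0 d x -> f x = f x0.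
Proof.
  intros BU sf df Bx.
  assert (S := fun i x s => box_step _ _ U x0 d f i x s BU sf (df i)).
  assert (B0 := ball_center x0 d).
  assert (B1 := ball_upd _ _ x0 _ d (inl i1) _ B0 (Bx _)).
  assert (B2 := ball_upd _ _ x0 _ d (inl i2) _ B1 (Bx _)).
  assert (B3 := ball_upd _ _ x0 _ d (inr i1) _ B2 (Bx _)).
  rewrite <- (S (inl i1) x0 (x (inl i1))), <- (S (inl i2) _ (x (inl i2)) B1),
    <- (S (inr i1) _ (x (inr i1)) B2), <- (S (inr i2) _ (x (inr i2)) B3) by auto.
  f_equal. apply functional_extensionality; intros [[] | []]; reflexivity.
Qed.

(** Continuity is asked for at points of the preimage only, because the coordinate change used later
    involves an antiderivative known only over the box. *)
Lemma open_box_preimage (x0 : two + two -> R) (d : R)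
  (psi : (two + two -> R) -> two + two -> R) :
  (forall y, ball x0 d (psi y) -> forall i, continuous (fun y => psi y i) y) ->
  open (fun y => ball x0 d (psi y)).
Proof.
  intros Hc y By.
  assert (L : forall i, locally y (fun y => ball (x0 i) d (psi y i))).
  { intros i. apply (Hc y By i (ball (x0 i) d)).
    set (e := (d - Rabs (psi y i - x0 i)) / 2).
    assert (Hd : Rabs (psi y i - x0 i) < d) by apply (By i).
    assert (e0 : 0 < e) by (unfold e; lra).
    exists (mkposreal e e0). intros z Hz.
    replace d with ((d - e) + e) by ring.
    apply (ball_triangle _ (psi y i)); [| exact Hz].
    assert (H : Rabs (psi y i - x0 i) < d - e) by (unfold e; lra).
    exact H. }
  generalize (filter_and _ _ (filter_and _ _ (L (inl i1)) (L (inl i2)))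
    (filter_and _ _ (L (inr i1)) (L (inr i2)))).
  apply filter_imp. intros z [[H1 H2] [H3 H4]] [[] | []]; assumption.
Qed.

(** * Reduction of a soliton to the stated form *)

Section Soliton.
Context (U : (two + two -> R) -> Prop) (g gi : tensor2 (two + two))
  (xi : two -> vfield (two + two)) (gt h f : tensor2 two)
  (X : vfield (two + two)) (Lambda eps : R) (P : scalar two).
Let O := orbit_space U.
Context (S : null_killing_soliton U g gi xi gt h f X Lambda)
  (N : normal_form O eps P gt h f)
  (f1_2 : forall t, O t -> pd i2 (f i1 i1) t <> 0).

Let a (k : two) : scalar two := f i1 k.
Let p : scalar two := h i1 i1.
Let w : scalar two := h i1 i2.

Lemma nks_O : open O.
Proof. apply open_orbit_space, (nks_open S). Qed.

Lemma nf_eps0 : eps <> 0.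
Proof. destruct (nf_eps N); lra. Qed.

Lemma smooth_a k : smooth O (a k).
Proof. apply (nks_smooth S). Qed.

Lemma smooth_p : smooth O p.
Proof. apply (nks_smooth S). Qed.

Lemma smooth_w : smooth O w.
Proof. apply (nks_smooth S). Qed.

Lemma smooth_X b : smooth U (X b).
Proof. apply (nks_soliton S). Qed.

Lemma nks_gE b c x : U x ->
  g b c x = eval (GE eps (Fn P) (Fn p) (Fn w) (fun k => Fn (a k)) b c) (tpart x).
Proof.
  intros Ux. assert (Ot := orbit_space_tpart U x Ux). fold O in Ot.
  rewrite (nks_adapted S) by easy.
  assert (E := nf_gt N). assert (E1 := nf_h21 N _ Ot).
  assert (E2 := nf_h22 N _ Ot). assert (E3 := fun k => nf_f2 N k _ Ot).
  unfold a, p, w.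
  destruct b as [[] | []], c as [[] | []]; cbn;
    rewrite ?E, ?E1, ?E2, ?E3 by easy; cbn; ring.
Qed.

Lemma X_inl i x : U x -> X (inl i) x = 0.
Proof.
  intros Ux. destruct (nks_tangent S x Ux) as [u Hu]. rewrite Hu.
  unfold comb. cbn [ix_sum two_index]. rewrite !(nks_coord S) by easy.
  unfold coord_field. destruct i; cbn; ring.
Qed.

Lemma pd_X_inl b i x : U x -> pd b (X (inl i)) x = 0.
Proof.
  intros Ux. rewrite (pd_ext_loc U _ (fun _ => 0) (nks_open S)); auto using X_inl.
  apply pd_const.
Qed.

(* The bracket of [X] with the horizontal lift of d/dt_i is both vertical and
   orthogonal to the non-null leaves. *)
Lemma pd_X_hor i k x : U x ->
  pd (inl i) (X (inr k)) x =
  ix_sum (fun l => (match i with i1 => a l (tpart x) | i2 => 0 end)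
    * pd (inr l) (X (inr k)) x).
Proof.
  set (e := fun i l => match i with i1 => a l | i2 => fun _ => 0 end).
  assert (se : forall i l, smooth O (e i l)).
  { intros [] l; simpl; [apply smooth_a | apply (smooth_const O 0 nks_O)]. }
  set (Y := fun (b : two + two) (x : two + two -> R) =>
    match b with inl j => kron i j | inr l => -1 * e i l (tpart x) end).
  assert (YE : forall b, exists E : @fexp two,
    wf O E /\ forall x, Y b x = eval E (tpart x)).
  { intros [j | l].
    - exists (Cst (kron i j)). easy.
    - exists (Mul (Cst (-1)) (Fn (e i l))). simpl; auto. }
  assert (oY : orth_section U g xi Y).
  { split.
    - intros b. destruct (YE b) as [E [wE HE]].
      apply (smooth_ext U (fun x => eval E (tpart x)) _ (nks_open S)); auto.
      apply smooth_tpart; [apply (nks_open S) |]. apply smooth_eval; auto using nks_O.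
    - intros l y Uy. unfold inner. cbn [ix_sum two_index sum_index].
      rewrite !(nks_coord S), !nks_gE by easy. unfold Y, e.
      destruct i, l; cbn; ring. }
  intros Ux.
  destruct (nks_symmetry S oY) as [_ H].
  set (v := fun l => bracket X Y (inr l) x).
  assert (E1 := H i1 x Ux). assert (E2 := H i2 x Ux).
  unfold inner in E1, E2. cbn [ix_sum two_index sum_index] in E1, E2.
  fold (v i1) (v i2) in E1, E2.
  rewrite !(nks_coord S), !nks_gE in E1, E2 by easy.
  assert (pY : forall l b, pd (inr l) (Y b) x = 0).
  { intros l b. destruct (YE b) as [E [_ HE]]. rewrite (pd_ext _ _ HE).
    apply pd_tpart_inr. }
  assert (bt : forall j, bracket X Y (inl j) x = 0).
  { intros j. unfold bracket. cbn [ix_sum two_index sum_index].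
    rewrite !X_inl, !pd_X_inl, !pY by easy. ring. }
  rewrite !bt in E1, E2.
  assert (w0 := nf_h12 N _ (orbit_space_tpart U x Ux)). fold w in w0.
  cbn -[bracket] in E1, E2.
  assert (v1 : v i1 = 0).
  { apply (Rmult_eq_reg_l (w (tpart x))); [| easy].
    rewrite Rmult_0_r, <- E2. ring. }
  assert (v2 : v i2 = 0).
  { apply (Rmult_eq_reg_l (w (tpart x))); [| easy].
    rewrite Rmult_0_r, <- E1, v1. ring. }
  assert (vk : v k = 0) by now destruct k.
  revert vk. unfold v, bracket. cbn [ix_sum two_index sum_index].
  rewrite !X_inl, !pY by easy. unfold Y, e. destruct i; cbn; lra.
Qed.

(** Differentiate d X^k/dt_1 = f_1^l d X^k/dz_l in t_2. Since d X^k/dt_2 vanishes identically, only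
    the terms in which f_1^l is differentiated survive. *)
Lemma pd_X_curv k x : U x ->
  ix_sum (fun l => pd i2 (a l) (tpart x) * pd (inr l) (X (inr k)) x) = 0.
Proof.
  intros Ux. assert (oU := nks_open S). assert (Ot := orbit_space_tpart U x Ux).
  assert (sX := smooth_X (inr k)).
  assert (Z : forall b y, U y -> pd b (pd (inl i2) (X (inr k))) y = 0).
  { intros b y Uy. rewrite (pd_ext_loc U _ (fun _ => 0) oU); auto using pd_const.
    intros z Uz. rewrite pd_X_hor by easy. cbn. ring. }
  assert (E := Z (inl i1) x Ux). rewrite (pd_pd_comm U) in E by easy.
  set (A := fun l => fun y => a l (tpart y)).
  set (e := Add (Mul (Fn (A i1)) (Fn (pd (inr i1) (X (inr k)))))
                (Mul (Fn (A i2)) (Fn (pd (inr i2) (X (inr k)))))).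
  assert (we : wf U e).
  { assert (sA : forall l, smooth U (A l)) by
      (intros; apply smooth_tpart; auto using smooth_a).
    simpl; auto 10 using smooth_pd. }
  rewrite (pd_ext_loc U _ (eval e) oU), (pd_eval U) in E; auto.
  - revert E. simpl. unfold A. rewrite !pd_tpart_inl.
    rewrite !(pd_pd_comm U _ (inl i2)), !Z by easy. lra.
  - intros y Uy. now rewrite pd_X_hor.
Qed.

(** As h_22 = 0, g(C,C) = C^1 (h_11 C^1 + 2 h_12 C^2), and C^1 is nonzero because d f_1^1/dt_2
    is. *)
Lemma null_curv t : O t -> p t * pd i2 (a i1) t + 2 * w t * pd i2 (a i2) t = 0.
Proof.
  intros Ot. assert (Ot' := Ot). destruct Ot' as [x [Ux Et]].
  assert (H := nks_null_curvature S x Ux).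
  unfold inner, curvature_field in H. cbn [ix_sum two_index sum_index] in H.
  rewrite Et in H. rewrite !nks_gE in H by easy. rewrite Et in H.
  set (s := sqrt (Rabs (det2 (fun i j => gt i j t)))).
  assert (s0 : s <> 0).
  { unfold s. intros E. apply sqrt_eq_0 in E; [| apply Rabs_pos].
    revert E. apply Rabs_no_R0. unfold det2. rewrite !(nf_gt N) by easy. simpl.
    generalize (exp_pos (- 2 * P t)), nf_eps0. intros He He0.
    rewrite Rmult_0_l, Rminus_0_r.
    repeat apply Rmult_integral_contrapositive_currified; lra. }
  assert (C : forall k, curvature_coef gt f k t = pd i2 (a k) t / s).
  { intros k. unfold curvature_coef. fold s. fold (a k).
    rewrite (pd_ext_loc O (f i2 k) (fun _ => 0) nks_O) by (auto; apply (nf_f2 N)).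
    rewrite pd_const. now rewrite Rminus_0_r. }
  rewrite !C in H. cbn in H.
  assert (H1 := f1_2 t Ot). fold (a i1) in H1.
  apply (Rmult_eq_reg_l (pd i2 (a i1) t / s / s)).
  - rewrite Rmult_0_r, <- H. field. easy.
  - repeat apply Rmult_integral_contrapositive_currified; auto using Rinv_neq_0_compat.
Qed.

(** * Constancy of h_12, C^1 and h_11 *)

Let gI b c x (Ux : U x) := metric_inv (nks_metric S) b c x Ux.

Lemma soliton_eq b c x : U x ->
  ricci g gi b c x = Lambda * g b c x
    - / 2 * ix_sum (fun k => g (inr k) c x * pd b (X (inr k)) x
        + g b (inr k) x * pd c (X (inr k)) x).
Proof.
  intros Ux. destruct (nks_soliton S) as [_ H]. specialize (H b c x Ux).
  unfold lie_tensor2 in H. cbn [ix_sum two_index sum_index] in *.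
  rewrite !pd_X_inl, !X_inl in H by easy.
  assert (pg : forall k, pd (inr k) (g b c) x = 0).
  { intros k. rewrite (pd_ext_loc U _ _ (nks_open S) (nks_gE b c)) by easy.
    apply pd_tpart_inr. }
  rewrite !pg in H. lra.
Qed.

(** Evaluate the soliton equation on a lift e_i and d/dz_k: g vanishes on this pair by
    orthogonality, and L_X g does because e_i annihilates the components of [X]. *)
Lemma curv_momentum i k t : O t ->
  eval (fD i (momE (Fn P) (Fn p) (Fn w) (fun l => Fn (a l)) k)) t = 0.
Proof.
  intros [x [Ux <-]].
  assert (Ot := orbit_space_tpart U x Ux). fold O in Ot.
  assert (w0 := nf_h12 N). fold w in w0.
  assert (e0 := nf_eps0).
  assert (H := fun i => ricci_hor_ver U eps (Fn P) (Fn p) (Fn w) (fun k => Fn (a k)) g gi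
    (nks_open S) e0 (nf_P N) smooth_p smooth_w smooth_a w0 nks_gE gI i k x Ux).
  assert (Z : forall i, ricci g gi (inl i) (inr k) x
    - ix_sum (fun l => eval (fE (fun k => Fn (a k)) i l) (tpart x)
        * ricci g gi (inr l) (inr k) x) = 0).
  { intros j. cbn [ix_sum two_index]. rewrite !soliton_eq by easy.
    cbn [ix_sum two_index]. rewrite !(pd_X_hor j), !nks_gE by easy.
    destruct j, k; cbn; field. }
  specialize (w0 _ Ot).
  destruct i.
  - specialize (H i2). rewrite Z in H. symmetry in H.
    apply Rmult_integral in H. destruct H as [H | H]; [| easy].
    revert H. intros H. exfalso. revert H. apply Rinv_neq_0_compat.
    simpl. lra.
  - specialize (H i1). rewrite Z in H. symmetry in H.
    apply Rmult_integral in H. destruct H as [H | H]; [| easy].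
    exfalso. revert H. apply Ropp_neq_0_compat, Rinv_neq_0_compat.
    repeat apply Rmult_integral_contrapositive_currified; auto.
Qed.

(* [Inv u * d_2 f_1^1], the first component of the curvature field. *)
Let curv1E : @fexp two := Mul (fD i2 (Fn (a i1))) (Inv (uE (Fn P))).

Lemma wf_uE : wf O (Inv (uE (Fn P))).
Proof.
  split; [split; [easy | apply (nf_P N)] |]. intros t _. apply Rgt_not_eq, exp_pos.
Qed.

Lemma wf_curv1E : wf O curv1E.
Proof. split; [apply wf_fD, smooth_a | apply wf_uE]. Qed.

Lemma psi_neq0 t : O t -> eval curv1E t <> 0.
Proof.
  intros Ot. apply Rmult_integral_contrapositive_currified.
  - now apply f1_2.
  - apply Rinv_neq_0_compat, Rgt_not_eq, exp_pos.
Qed.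

Lemma pd_X1_z2 x : U x -> pd (inr i2) (X (inr i1)) x =
  - / (2 * eps) * w (tpart x) * eval curv1E (tpart x) ^ 2.
Proof.
  intros Ux. assert (Ot := orbit_space_tpart U x Ux). fold O in Ot.
  assert (w0 := nf_h12 N). fold w in w0. assert (e0 := nf_eps0).
  assert (H := ricci_22 U eps (Fn P) (Fn p) (Fn w) (fun k => Fn (a k)) g gi
    (nks_open S) e0 (nf_P N) smooth_p smooth_w smooth_a w0 nks_gE gI x Ux).
  rewrite soliton_eq in H by easy. cbn [ix_sum two_index] in H.
  rewrite !nks_gE in H by easy. specialize (w0 _ Ot).
  apply (Rmult_eq_reg_l (w (tpart x))); [| easy].
  cbn -[pow] in *.
  transitivity (- (Lambda * 0 -
    / 2 *
    (w (tpart x) * pd (inr i2) (X (inr i1)) x +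
     w (tpart x) * pd (inr i2) (X (inr i1)) x +
     (0 * pd (inr i2) (X (inr i2)) x + 0 * pd (inr i2) (X (inr i2)) x)))); [field |].
  rewrite H. field. split; [apply Rgt_not_eq, exp_pos | easy].
Qed.

Lemma pd_pd_X1_z2 i x : U x -> pd (inl i) (pd (inr i2) (X (inr i1))) x = 0.
Proof.
  intros Ux. assert (oU := nks_open S). assert (sX := smooth_X (inr i1)).
  rewrite (pd_pd_comm U) by easy. destruct i.
  - set (A := fun l => fun y => a l (tpart y)).
    set (e := Add (Mul (Fn (A i1)) (Fn (pd (inr i1) (X (inr i1)))))
                  (Mul (Fn (A i2)) (Fn (pd (inr i2) (X (inr i1)))))).
    assert (we : wf U e).
    { assert (sA : forall l, smooth U (A l)) by
      (intros; apply smooth_tpart; auto using smooth_a).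
      simpl; auto 10 using smooth_pd. }
    assert (Z : forall l, pd (inr l) (pd (inr i2) (X (inr i1))) x = 0).
    { intros l. rewrite (pd_ext_loc U _ _ oU pd_X1_z2) by easy.
      apply (pd_tpart_inr (fun t => - / (2 * eps) * w t * eval curv1E t ^ 2)). }
    rewrite (pd_ext_loc U _ (eval e) oU), (pd_eval U); auto.
    + simpl. unfold A. rewrite !pd_tpart_inr.
      rewrite (pd_pd_comm U _ (inr i2) (inr i1)), !Z by easy. ring.
    + intros y Uy. now rewrite pd_X_hor.
  - rewrite (pd_ext_loc U _ (fun _ => 0) oU); auto using pd_const.
    intros z Uz. rewrite pd_X_hor by easy. cbn. ring.
Qed.

(** Write q for [curv1E]. Both w^2 q and w q^2 have vanishing derivatives; this is a linear system
    for the derivatives of w and q with determinant 3 w^2 q^2, which is nonzero. *)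
Lemma pd_w_psi i t : O t -> pd i w t = 0 /\ eval (fD i curv1E) t = 0.
Proof.
  intros Ot. assert (w0 := nf_h12 N t Ot). fold w in w0.
  assert (q0 := psi_neq0 t Ot). assert (e0 := nf_eps0).
  assert (H1 : 2 * w t * pd i w t * eval curv1E t + w t ^ 2 * eval (fD i curv1E) t = 0).
  { rewrite <- (curv_momentum i i2 t Ot). cbn. field. apply Rgt_not_eq, exp_pos. }
  assert (H2 : pd i w t * eval curv1E t ^ 2
      + 2 * w t * eval curv1E t * eval (fD i curv1E) t = 0).
  { destruct Ot as [x [Ux Et]].
    assert (E := pd_pd_X1_z2 i x Ux).
    rewrite (pd_ext_loc U _ _ (nks_open S) pd_X1_z2) in E by easy.
    set (e := Mul (Cst (- / (2 * eps))) (Mul (Fn w) (Mul curv1E curv1E))).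
    rewrite (pd_ext _ (fun y => eval e (tpart y))) in E.
    - rewrite pd_tpart_inl, (pd_eval O) in E.
      + rewrite Et in E. unfold e in E.
        apply (Rmult_eq_reg_l (- / (2 * eps))).
        * rewrite Rmult_0_r, <- E. cbn -[curv1E]. ring.
        * apply Ropp_neq_0_compat, Rinv_neq_0_compat. lra.
      + unfold e. assert (H := wf_curv1E). assert (H' := smooth_w).
        cbn [wf]. auto.
      + now apply orbit_space_tpart.
    - intros y. unfold e. cbn [eval]. ring. }
  assert (Z : pd i w t = 0).
  { apply (Rmult_eq_reg_l (-3 * w t * eval curv1E t ^ 2)).
    - transitivity (w t * (pd i w t * eval curv1E t ^ 2
        + 2 * w t * eval curv1E t * eval (fD i curv1E) t)
        - 2 * eval curv1E t * (2 * w t * pd i w t * eval curv1E t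
          + w t ^ 2 * eval (fD i curv1E) t)); [ring |]. rewrite H1, H2. ring.
    - apply Rmult_integral_contrapositive_currified; [| now apply pow_nonzero].
      apply Rmult_integral_contrapositive_currified; [lra | easy]. }
  split; [easy |].
  rewrite Z in H1. apply (Rmult_eq_reg_l (w t ^ 2)); [lra | now apply pow_nonzero].
Qed.

(** By [null_curv] the first component of the momentum is w p C^1 / 2; it is constant, and so are w
    and C^1. *)
Lemma pd_p i t : O t -> pd i p t = 0.
Proof.
  intros Ot. assert (w0 := nf_h12 N t Ot). fold w in w0.
  assert (q0 := psi_neq0 t Ot). destruct (pd_w_psi i t Ot) as [Zw Zq].
  assert (E := curv_momentum i i1 t Ot).
  set (m := momE _ _ _ _ _) in E.
  assert (wm : wf O m).
  { assert (H := wf_uE). assert (H1 := smooth_a). assert (H2 := smooth_w).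
    assert (H3 := smooth_p). unfold m, momE.
    split; [easy |]. split; [| apply H].
    split; split; try apply H2; try apply H3; apply smooth_pd, H1. }
  set (e := Mul (Cst (/ 2)) (Mul (Fn w) (Mul (Fn p) curv1E))).
  assert (we : wf O e).
  { split; [easy |]. split; [apply smooth_w |].
    split; [apply smooth_p | apply wf_curv1E]. }
  assert (me : forall s, O s -> eval m s = eval e s).
  { intros s Os. assert (H := null_curv s Os). cbn.
    assert (H' : w s * pd i2 (a i2) s = - / 2 * (p s * pd i2 (a i1) s)) by lra.
    rewrite H'. field. apply Rgt_not_eq, exp_pos. }
  rewrite <- (pd_eval O), (pd_ext_loc O _ _ nks_O me), (pd_eval O) in E by easy.
  unfold e in E. cbn -[curv1E] in E. rewrite Zw, Zq in E.
  apply (Rmult_eq_reg_l (/ 2 * (w t * eval curv1E t))).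
  - rewrite Rmult_0_r, <- E. ring.
  - apply Rmult_integral_contrapositive_currified; [lra |].
    now apply Rmult_integral_contrapositive_currified.
Qed.

(** * The metric and the derivatives of X on a box around x0 *)

Context (x0 : two + two -> R) (d : posreal) (BU : forall x, ball x0 d x -> U x).
Let t0 := tpart x0.
Let V (x : two + two -> R) : Prop := ball x0 d x.
Let w0 := w t0.
Let kappa := eval curv1E t0.
(** The slope of the second null direction d/dz_1 + r d/dz_2 of the leaves, which C spans: C^2 = r
    C^1. *)
Let r := - p t0 / (2 * w0).

Lemma V_tpart x : V x -> ball t0 d (tpart x).
Proof. intros Vx i. apply Vx. Qed.

Lemma box_O t : ball t0 d t -> O t.
Proof.
  intros Bt. exists (fun b => match b with inl i => t i | inr k => x0 (inr k) end).
  split; [| easy]. apply BU. intros [i | k]; [apply Bt | apply ball_center].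
Qed.

Lemma w_const t : ball t0 d t -> w t = w0.
Proof.
  apply (box_const2 O t0 d w t box_O smooth_w).
  intros i y By. now apply pd_w_psi, box_O.
Qed.

Lemma p_const t : ball t0 d t -> p t = - 2 * w0 * r.
Proof.
  intros Bt. rewrite (box_const2 O t0 d p t box_O smooth_p); auto.
  - unfold r. field. apply (nf_h12 N), box_O, ball_center.
  - intros i y By. now apply pd_p, box_O.
Qed.

Lemma psi_const t : ball t0 d t -> eval curv1E t = kappa.
Proof.
  apply (box_const2 O t0 d (eval curv1E) t box_O).
  - apply smooth_eval; [apply nks_O | apply wf_curv1E].
  - intros i y By. assert (Oy := box_O y By).
    rewrite (pd_eval O) by auto using wf_curv1E. now apply pd_w_psi.
Qed.

Lemma w0_neq0 : w0 <> 0.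
Proof. apply (nf_h12 N), box_O, ball_center. Qed.

Lemma kappa_neq0 : kappa <> 0.
Proof. apply psi_neq0, box_O, ball_center. Qed.

Lemma pd_a1 t : ball t0 d t -> pd i2 (a i1) t = kappa * exp (- 2 * P t).
Proof.
  intros Bt. rewrite <- (psi_const t Bt). cbn. field. apply Rgt_not_eq, exp_pos.
Qed.

Lemma pd_a2 t : ball t0 d t -> pd i2 (a i2) t = r * kappa * exp (- 2 * P t).
Proof.
  intros Bt. assert (H := null_curv t (box_O t Bt)).
  rewrite w_const, p_const, pd_a1 in H by easy.
  apply (Rmult_eq_reg_l (2 * w0)).
  - lra.
  - generalize w0_neq0. lra.
Qed.

Lemma V_gE b c x : V x -> g b c x =
  eval (GE eps (Fn P) (Cst (- 2 * w0 * r)) (Cst w0) (fun k => Fn (a k)) b c) (tpart x).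
Proof.
  intros Vx. rewrite nks_gE by now apply BU.
  assert (Ew := w_const _ (V_tpart x Vx)). assert (Ep := p_const _ (V_tpart x Vx)).
  destruct b as [[] | []], c as [[] | []]; cbn; rewrite ?Ew, ?Ep; reflexivity.
Qed.

Lemma open_V : open V.
Proof.
  apply (open_box_preimage x0 d (fun x => x)). intros y _ i. apply continuous_coord.
Qed.

Lemma orbit_V t : orbit_space V t -> ball t0 d t.
Proof. intros [x [Vx <-]]. now apply V_tpart. Qed.

Lemma V_ricci b c x : V x ->
  ricci g gi b c x =
  match b, c with
  | inl i1, inl i1 => pd i1 (pd i1 P) (tpart x) + / eps * pd i2 (pd i2 P) (tpart x)
  | inl i2, inl i2 => eps * pd i1 (pd i1 P) (tpart x) + pd i2 (pd i2 P) (tpart x)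
  | _, _ => 0
  end + / (2 * eps) * curv_form w0 r kappa a b (tpart x)
    * curv_form w0 r kappa a c (tpart x).
Proof.
  assert (OV : forall t, orbit_space V t -> O t) by (intros; now apply box_O, orbit_V).
  apply (ricci_flat V eps w0 r kappa P a g gi open_V nf_eps0 w0_neq0
    (smooth_mono _ _ _ OV (nf_P N)) (fun k => smooth_mono _ _ _ OV (smooth_a k)) V_gE).
  - intros b' c' y Vy. apply gI. now apply BU.
  - intros t Ot. now apply pd_a1, orbit_V.
  - intros t Ot. now apply pd_a2, orbit_V.
Qed.

Let m := - w0 * kappa ^ 2 / (2 * eps).

Lemma m_neq0 : m <> 0.
Proof.
  assert (H := w0_neq0). assert (H1 := kappa_neq0). assert (H2 := nf_eps0).
  unfold m. apply Rmult_integral_contrapositive_currified.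
  - apply Rmult_integral_contrapositive_currified; [lra | now apply pow_nonzero].
  - apply Rinv_neq_0_compat. lra.
Qed.

Lemma curv_X k x : V x ->
  pd (inr i1) (X (inr k)) x = - r * pd (inr i2) (X (inr k)) x.
Proof.
  intros Vx. assert (H := pd_X_curv k x (BU x Vx)). cbn [ix_sum two_index] in H.
  assert (Bt := V_tpart x Vx).
  rewrite pd_a1, pd_a2 in H by easy.
  apply (Rmult_eq_reg_l (kappa * exp (- 2 * P (tpart x)))); [lra |].
  apply Rmult_integral_contrapositive_currified; [apply kappa_neq0 |].
  apply Rgt_not_eq, exp_pos.
Qed.

Lemma X1_z2 x : V x -> pd (inr i2) (X (inr i1)) x = m.
Proof.
  intros Vx. rewrite pd_X1_z2 by now apply BU.
  rewrite w_const, psi_const by now apply V_tpart. unfold m. field. apply nf_eps0.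
Qed.

(** The (z_1, z_2) component of the soliton equation; after [curv_X] and [X1_z2] its only unknown is
    d X^2/dz_2. *)
Lemma X2_z2 x : V x -> pd (inr i2) (X (inr i2)) x = 2 * Lambda + r * m.
Proof.
  intros Vx. assert (H := soliton_eq (inr i1) (inr i2) x (BU x Vx)).
  rewrite V_ricci in H by easy. cbn [ix_sum two_index] in H.
  rewrite !V_gE, !curv_X, X1_z2 in H by easy. cbn -[kappa] in H.
  assert (H1 := w0_neq0). assert (H2 := nf_eps0).
  apply (Rmult_eq_reg_l (- (/ 2 * w0))); [| lra].
  transitivity (Lambda * w0 -
    / 2 * (w0 * (- r * m) + -2 * w0 * r * m +
     (0 * (- r * pd (inr i2) (X (inr i2)) x) + w0 * pd (inr i2) (X (inr i2)) x))
     - (Lambda * w0 + / 2 * (3 * w0 * r * m))); [ring |].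
  rewrite <- H. unfold m. field. easy.
Qed.

(** The (t_2, t_2) component is the convenient one: as f_2 = 0, neither [X] nor the curvature form
    enters it. *)
Lemma V_pde t : ball t0 d t ->
  pd i1 (pd i1 P) t + eps * pd i2 (pd i2 P) t = Lambda * exp (- 2 * P t).
Proof.
  intros Bt.
  set (x := fun b => match b with inl i => t i | inr k => x0 (inr k) end).
  assert (Vx : V x) by (intros [i | k]; [apply Bt | apply ball_center]).
  assert (H := soliton_eq (inl i2) (inl i2) x (BU x Vx)).
  rewrite V_ricci in H by easy. cbn [ix_sum two_index] in H.
  rewrite !V_gE in H by easy. change (tpart x) with t in H. cbn in H.
  assert (H2 := nf_eps0).
  assert (E : eps * eps = 1) by (destruct (nf_eps N) as [-> | ->]; ring).
  apply (Rmult_eq_reg_l eps); [| easy].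
  rewrite Rmult_plus_distr_l, <- Rmult_assoc, E, Rmult_1_l.
  revert H. lra.
Qed.

(** * The coordinate change *)

Let b (t : two -> R) : R := a i2 t - r * a i1 t.
(* The dependence of X^1 on t_1 provides an antiderivative of [b], which is a
   function of t_1 only. *)
Let B (s : R) : R := X (inr i1) (upd x0 (inl i1) s) / m.
Let Bx (x : two + two -> R) : R := B (x (inl i1)).

(** Since d X^1/dz_1 = - r m and d X^1/dz_2 = m, the lift equation [pd_X_hor] reads d X^1/dt_1 = m
    b. *)
Lemma is_derive_B t : ball t0 d t -> is_derive B (t i1) (b t).
Proof.
  intros Bt. set (y := upd x0 (inl i1) (t i1)).
  assert (Vy : V y) by (apply ball_upd; [apply ball_center | apply (Bt i1)]).
  (* [B] is taken along the line through [x0], where t_2 is fixed; b does not depend on t_2 because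
     d f_1^2/dt_2 = r d f_1^1/dt_2. *)
  assert (Hb : b t = b (tpart y)).
  { set (e := Add (Fn (a i2)) (Mul (Cst (- r)) (Fn (a i1)))).
    assert (we : wf O e) by (simpl; auto using smooth_a).
    assert (be : forall s, b s = eval e s) by (intros s; unfold b; simpl; ring).
    rewrite !be. rewrite <- (box_step _ _ O t0 d (eval e) i2 t (t0 i2) box_O).
    - f_equal. apply functional_extensionality. intros []; reflexivity.
    - apply smooth_eval; [apply nks_O | easy].
    - intros s Bs. rewrite (pd_eval O) by auto using box_O. simpl.
      rewrite pd_a1, pd_a2 by easy. ring.
    - easy.
    - apply ball_center. }
  assert (H : is_derive (fun s => X (inr i1) (upd y (inl i1) s)) (y (inl i1))
    (pd (inl i1) (X (inr i1)) y)).
  { apply Derive_correct.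
    apply (smooth_ex_derive U _ y (inl i1) (smooth_X (inr i1)) (BU y Vy)). }
  rewrite pd_X_hor in H by now apply BU. cbn [ix_sum two_index] in H.
  rewrite curv_X, X1_z2 in H by easy.
  replace (y (inl i1)) with (t i1) in H by (unfold y; now rewrite upd_eq).
  rewrite Hb. unfold B.
  apply (is_derive_ext (fun s => / m * X (inr i1) (upd y (inl i1) s))).
  - intros s. unfold Rdiv. rewrite Rmult_comm. do 2 f_equal.
    apply functional_extensionality; intros j. unfold y, upd.
    now destruct (ix_dec j (inl i1)).
  - evar_last; [apply is_derive_scal, H |].
    unfold b. field. apply m_neq0.
Qed.

Lemma pd_Bx c x : ball t0 d (tpart x) ->
  pd c Bx x = match c with inl i1 => b (tpart x) | _ => 0 end.
Proof.
  intros Bt. unfold pd, Bx. assert (D := is_derive_B _ Bt).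
  destruct c as [[] | k].
  - rewrite (Derive_ext _ B) by (intros; now rewrite upd_eq).
    now apply is_derive_unique.
  - rewrite (Derive_ext _ (fun _ => B (x (inl i1)))); [apply Derive_const |].
    intros s. now rewrite upd_neq.
  - rewrite (Derive_ext _ (fun _ => B (x (inl i1)))); [apply Derive_const |].
    intros s. now rewrite upd_neq.
Qed.

Lemma continuous_Bx x : ball t0 d (tpart x) -> continuous Bx x.
Proof.
  intros Bt. apply (continuous_comp (fun x => x (inl i1)) B).
  - apply continuous_coord.
  - apply (@ex_derive_continuous R_AbsRing R_NormedModule).
    eexists. apply (is_derive_B _ Bt).
Qed.

(* The domain of [Bx], which contains both [V] and its image. *)
Let Z (x : two + two -> R) : Prop := orbit_space V (tpart x).

Lemma open_Z : open Z.
Proof.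
  intros x Zx. apply (continuous_tpart x (orbit_space V)).
  now apply open_orbit_space; [apply open_V |].
Qed.

Lemma smooth_Bx : smooth Z Bx.
Proof.
  assert (WB : forall x, Z x -> ball t0 d (tpart x)) by (intros; now apply orbit_V).
  apply smooth_of_pd; [apply open_Z | |].
  - intros x Wx. split; [now apply continuous_Bx, WB |].
    intros c. assert (D := is_derive_B _ (WB x Wx)). destruct c as [[] | k].
    + apply (ex_derive_ext B); [intros; unfold Bx; now rewrite upd_eq |].
      eexists. apply D.
    + apply (ex_derive_ext (fun _ => B (x (inl i1)))); [| apply ex_derive_const].
      intros s. unfold Bx. now rewrite upd_neq.
    + apply (ex_derive_ext (fun _ => B (x (inl i1)))); [| apply ex_derive_const].
      intros s. unfold Bx. now rewrite upd_neq.
  - intros c.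
    set (e := match c with
      | inl i1 => Add (Fn (a i2)) (Mul (Cst (- r)) (Fn (a i1)))
      | _ => Zero end).
    exists (fun x => eval e (tpart x)). split.
    + apply smooth_tpart; [apply open_Z |].
      assert (oOW := open_orbit_space Z open_Z).
      assert (WO : forall t, orbit_space Z t -> O t).
      { intros t [x [Wx <-]]. now apply box_O, WB. }
      assert (sa := fun k => smooth_mono _ _ _ WO (smooth_a k)).
      apply smooth_eval; [easy |]. unfold e. destruct c as [[] | k]; simpl; auto.
    + intros x Wx. rewrite pd_Bx by now apply WB. unfold e, b.
      destruct c as [[] | k]; simpl; ring.
Qed.

(** With th_k = dz_k + f_1^k dt_1, the form th_2 - r th_1 = dz_2 - r dz_1 + b dt_1 has the primitive
    z_2 - r z_1 + [Bx]. The factor 1 / kappa on z_1 normalises d f_1^1/dt_2 = kappa e^{-2P} to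
    e^{-2P}; the factor w0 kappa on the primitive compensates for it and absorbs h_12. *)
Definition phiE (j : two + two) : @fexp (two + two) :=
  match j with
  | inl i => Fn (fun x => x (inl i))
  | inr i1 => Mul (Cst (/ kappa)) (Fn (fun x => x (inr i1)))
  | inr i2 => Mul (Cst (w0 * kappa))
      (Add (Add (Fn (fun x => x (inr i2))) (Mul (Cst (- r)) (Fn (fun x => x (inr i1)))))
        (Fn Bx))
  end.

Definition psiE (j : two + two) : @fexp (two + two) :=
  match j with
  | inl i => Fn (fun x => x (inl i))
  | inr i1 => Mul (Cst kappa) (Fn (fun x => x (inr i1)))
  | inr i2 => Add (Add (Mul (Cst (/ (w0 * kappa))) (Fn (fun x => x (inr i2))))
      (Mul (Cst (r * kappa)) (Fn (fun x => x (inr i1)))))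
      (Mul (Cst (-1)) (Fn Bx))
  end.

Definition phi (x : two + two -> R) : two + two -> R := fun j => eval (phiE j) x.
Definition psi (x : two + two -> R) : two + two -> R := fun j => eval (psiE j) x.

Let W (y : two + two -> R) : Prop := V (psi y).

Lemma psi_phi x : psi (phi x) = x.
Proof.
  assert (H := w0_neq0). assert (H1 := kappa_neq0).
  apply functional_extensionality. intros [[] | []]; try reflexivity.
  - cbn -[kappa w0 r Bx]. field. easy.
  - cbn -[kappa w0 r Bx]. change (Bx (phi x)) with (Bx x). field. easy.
Qed.

Lemma phi_psi x : phi (psi x) = x.
Proof.
  assert (H := w0_neq0). assert (H1 := kappa_neq0).
  apply functional_extensionality. intros [[] | []]; try reflexivity.
  - cbn -[kappa w0 r Bx]. field. easy.
  - cbn -[kappa w0 r Bx]. change (Bx (psi x)) with (Bx x). field. easy.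
Qed.

Lemma wf_phiE j : wf Z (phiE j).
Proof.
  assert (H := fun i => smooth_coord Z i open_Z). assert (HB := smooth_Bx).
  destruct j as [i | []]; simpl; auto 10.
Qed.

Lemma wf_psiE j : wf Z (psiE j).
Proof.
  assert (H := fun i => smooth_coord Z i open_Z). assert (HB := smooth_Bx).
  destruct j as [i | []]; simpl; auto 10.
Qed.

Lemma V_Z x : V x -> Z x.
Proof. intros Vx. now exists x. Qed.

Lemma W_Z y : W y -> Z y.
Proof. intros Wy. now exists (psi y). Qed.

Lemma open_W : open W.
Proof.
  apply open_box_preimage. intros y Wy j.
  apply (eval_correct Z (psiE j)); [apply wf_psiE | now apply W_Z].
Qed.

Lemma phi_diffeo : diffeo V W phi psi.
Proof.
  split; [| split; [| split]].
  - intros j. apply (smooth_mono Z V _ V_Z). apply smooth_eval; [apply open_Z | apply wf_phiE].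
  - intros j. apply (smooth_mono Z W _ W_Z). apply smooth_eval; [apply open_Z | apply wf_psiE].
  - intros x Vx. split; [| apply psi_phi]. unfold W. now rewrite psi_phi.
  - intros y Wy. split; [easy | apply phi_psi].
Qed.

Lemma pd_phi c j x : V x ->
  pd c (fun y => phi y j) x =
  match j with
  | inl i => kron c (inl i)
  | inr i1 => kron c (inr i1) / kappa
  | inr i2 => w0 * kappa * (kron c (inr i2) - r * kron c (inr i1)
      + match c with inl i1 => b (tpart x) | _ => 0 end)
  end.
Proof.
  intros Vx. rewrite (pd_eval Z (phiE j)) by auto using wf_phiE, V_Z.
  destruct j as [i | []]; cbn -[kappa w0 r Bx b kron];
    rewrite ?pd_Bx, ?pd_coord by now apply V_tpart.
  - easy.
  - unfold Rdiv. ring.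
  - ring.
Qed.

Let F (t : two -> R) : R := a i1 t / kappa.

Lemma soliton_local_form :
  exists (V W : (two + two -> R) -> Prop)
    (phi psi : (two + two -> R) -> two + two -> R)
    (c a1 a2 : R) (Q F : scalar two),
    open V /\ V x0 /\ (forall x, V x -> U x) /\ open W /\
    diffeo V W phi psi /\ adapted_chart V xi phi /\
    soliton_data (orbit_space W) eps Lambda Q F /\
    (forall a b x, V x ->
       g a b x = pullback phi (soliton_metric eps c Q F) a b x) /\
    (forall a x, V x ->
       pushforward phi X a x = soliton_field eps Lambda c a1 a2 a (phi x)) /\
    gauss_curvature (orbit_space W) (conformal_metric eps Q)
      (fun _ => Lambda).
Proof.
  assert (Hw := w0_neq0). assert (Hk := kappa_neq0). assert (He := nf_eps0).
  assert (oW := open_W).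
  assert (E1 : / eps = eps) by (destruct (nf_eps N) as [E | E]; rewrite E; field).
  assert (Em : m = - (w0 * kappa ^ 2 * eps / 2)).
  { unfold m. rewrite <- E1 at 2. field. easy. }
  assert (WB : forall t, orbit_space W t -> ball t0 d t).
  { intros t [y [Wy Et]]. rewrite <- Et. now apply orbit_V, W_Z. }
  assert (WO : forall t, orbit_space W t -> O t) by (intros; now apply box_O, WB).
  assert (sP := smooth_mono _ _ _ WO (nf_P N)).
  (* In the new coordinates, each vertical component of [X] minus its stated linear part for c = 0
     has zero gradient on the box, hence equals its value at [x0]. *)
  assert (field1 : forall x, V x -> X (inr i1) x / kappa + eps / 2 * phi x (inr i2)
    = X (inr i1) x0 / kappa + eps / 2 * phi x0 (inr i2)).
  { set (e := Add (Mul (Cst (/ kappa)) (Fn (X (inr i1)))) (Mul (Cst (eps / 2))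
      (phiE (inr i2)))).
    assert (we : wf V e).
    { assert (sX := smooth_mono _ _ _ BU (smooth_X (inr i1))).
      assert (H := wf_mono Z V _ V_Z (wf_phiE (inr i2))). cbn -[phiE]. auto 10. }
    intros x Vx. assert (H : eval e x = eval e x0).
    { apply (box_const4 V x0 d); auto using smooth_eval, open_V.
      intros c y Vy. rewrite (pd_eval V) by easy.
      unfold e. cbn [fD eval]. rewrite <- (pd_eval Z (phiE _)) by auto using wf_phiE, V_Z.
      change (eval (phiE (inr i2))) with (fun y => phi y (inr i2)).
      rewrite pd_phi by easy. assert (Uy := BU y Vy).
      destruct c as [[] | []]; cbn -[kappa w0 r b].
      - rewrite pd_X_hor by easy. cbn -[kappa w0 r b m]. rewrite curv_X, X1_z2 by easy.
        unfold b. rewrite Em. field. easy.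
      - rewrite pd_X_hor by easy. cbn. ring.
      - rewrite curv_X, X1_z2 by easy. rewrite Em. field. easy.
      - rewrite X1_z2 by easy. rewrite Em. field. easy. }
    unfold e in H. cbn [eval] in H. unfold phi. unfold Rdiv at 1 3. lra. }
  assert (field2 : forall x, V x ->
    w0 * kappa * (X (inr i2) x - r * X (inr i1) x) - 2 * Lambda * phi x (inr i2)
    = w0 * kappa * (X (inr i2) x0 - r * X (inr i1) x0) - 2 * Lambda * phi x0 (inr i2)).
  { set (e := Add (Mul (Cst (w0 * kappa)) (Add (Fn (X (inr i2)))
      (Mul (Cst (- r)) (Fn (X (inr i1))))))
      (Mul (Cst (- 2 * Lambda)) (phiE (inr i2)))).
    assert (we : wf V e).
    { assert (sX := fun k => smooth_mono _ _ _ BU (smooth_X (inr k))).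
      assert (H := wf_mono Z V _ V_Z (wf_phiE (inr i2))). cbn -[phiE]. auto 10. }
    intros x Vx. assert (H : eval e x = eval e x0).
    { apply (box_const4 V x0 d); auto using smooth_eval, open_V.
      intros c y Vy. rewrite (pd_eval V) by easy.
      unfold e. cbn [fD eval]. rewrite <- (pd_eval Z (phiE _)) by auto using wf_phiE, V_Z.
      change (eval (phiE (inr i2))) with (fun y => phi y (inr i2)).
      rewrite pd_phi by easy. assert (Uy := BU y Vy).
      destruct c as [[] | []]; cbn -[kappa w0 r b].
      - rewrite !pd_X_hor by easy. cbn -[kappa w0 r b m].
        rewrite !curv_X, X1_z2, X2_z2 by easy. unfold b. ring.
      - rewrite !pd_X_hor by easy. cbn -[kappa w0 r b]. ring.
      - rewrite !curv_X, X1_z2, X2_z2 by easy. ring.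
      - rewrite X1_z2, X2_z2 by easy. ring. }
    unfold e in H. cbn [eval] in H. unfold phi.
    apply (Rplus_eq_reg_l 0). revert H. lra. }
  (* c = 0 because the new z_2 comes from th_2 - r th_1, so both d/dz_1 and d/dz_2 are null in the
     new coordinates. The constants a1 and a2 are the values found in [field1] and [field2]. *)
  exists V, W, phi, psi, 0, (X (inr i1) x0 / kappa + eps / 2 * phi x0 (inr i2)),
    (w0 * kappa * (X (inr i2) x0 - r * X (inr i1) x0) - 2 * Lambda * phi x0 (inr i2)),
    P, F.
  split; [apply open_V |]. split; [apply ball_center |]. split; [exact BU |].
  split; [easy |]. split; [apply phi_diffeo |]. split; [| split; [| split; [| split]]].
  - exists (fun k l => match k, l with
      | i1, i1 => / kappa | i1, i2 => - (w0 * kappa * r)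
      | i2, i1 => 0 | i2, i2 => w0 * kappa end).
    split.
    + unfold det2. replace (_ - _) with w0 by (field; easy). easy.
    + intros k j x Vx. unfold pushforward. cbn [ix_sum two_index sum_index].
      rewrite !pd_phi, !(nks_coord S) by (try apply BU; easy).
      destruct k, j as [[] | []]; cbn -[kappa w0 r b]; field; easy.
  - split.
    + exact sP.
    + apply (smooth_mono O _ _ WO).
      apply (smooth_eval O (Mul (Fn (a i1)) (Cst (/ kappa))) nks_O).
      simpl; auto using smooth_a.
    + intros t Wt. assert (Bt := WB t Wt).
      transitivity (pd i2 (eval (Mul (Cst (/ kappa)) (Fn (a i1)))) t).
      * apply pd_ext. intros s. unfold F. cbn -[kappa]. unfold Rdiv. ring.
      * rewrite (pd_eval O) by (simpl; auto using smooth_a). cbn -[kappa].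
        rewrite pd_a1 by easy. field. easy.
    + intros t Wt. now apply V_pde, WB.
  - intros c c' x Vx. rewrite V_gE by easy. unfold pullback.
    cbn [ix_sum two_index sum_index]. rewrite !pd_phi by easy.
    destruct c as [[] | []], c' as [[] | []]; cbn -[kappa w0 r];
      change (tpart (phi x)) with (tpart x); unfold F, b; field; easy.
  - intros c x Vx. assert (H1 := field1 x Vx). assert (H2 := field2 x Vx).
    unfold pushforward. cbn [ix_sum two_index sum_index].
    rewrite !pd_phi, !X_inl by (try apply BU; easy).
    destruct c as [[] | []]; cbn -[kappa w0 r b phi].
    + ring.
    + ring.
    + rewrite <- H1. field. easy.
    + rewrite <- H2. field.
  - apply gauss_conformal; auto.
    + now apply open_orbit_space.
    + intros t Wt. rewrite E1. now apply V_pde, WB.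
Qed.
End Soliton.

Theorem theorem1 :
  (* every such soliton has the stated local form *)
  (forall (U : (two + two -> R) -> Prop) (g gi : tensor2 (two + two))
      (xi : two -> vfield (two + two)) (gt h f : tensor2 two)
      (X : vfield (two + two)) (Lambda eps : R) (P : scalar two),
    null_killing_soliton U g gi xi gt h f X Lambda ->
    normal_form (orbit_space U) eps P gt h f ->
    (forall t, orbit_space U t -> pd i2 (f i1 i1) t <> 0) ->
    forall x0, U x0 ->
    exists (V W : (two + two -> R) -> Prop)
      (phi psi : (two + two -> R) -> two + two -> R)
      (c a1 a2 : R) (Q F : scalar two),
      open V /\ V x0 /\ (forall x, V x -> U x) /\ open W /\
      diffeo V W phi psi /\ adapted_chart V xi phi /\
      soliton_data (orbit_space W) eps Lambda Q F /\
      (forall a b x, V x ->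
         g a b x = pullback phi (soliton_metric eps c Q F) a b x) /\
      (forall a x, V x ->
         pushforward phi X a x = soliton_field eps Lambda c a1 a2 a (phi x)) /\
      gauss_curvature (orbit_space W) (conformal_metric eps Q)
        (fun _ => Lambda))
  /\
  (* the constants and the solution of the equation are arbitrary *)
  (forall (W : (two + two -> R) -> Prop) (eps Lambda c a1 a2 : R)
      (P F : scalar two),
    open W -> eps = 1 \/ eps = -1 ->
    soliton_data (orbit_space W) eps Lambda P F ->
    exists (gi : tensor2 (two + two)) (h f : tensor2 two),
      null_killing_soliton W (soliton_metric eps c P F) gi
        (fun k => coord_field (inr k)) (conformal_metric eps P) h f
        (soliton_field eps Lambda c a1 a2) Lambda /\
      normal_form (orbit_space W) eps P (conformal_metric eps P) h f /\
      (forall t, orbit_space W t -> pd i2 (f i1 i1) t <> 0))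
  /\
  (* every Lambda occurs: expanding, steady and shrinking *)
  (forall eps Lambda : R, eps = 1 \/ eps = -1 ->
    exists (W : (two + two -> R) -> Prop) (P F : scalar two),
      open W /\ (exists x, W x) /\
      soliton_data (orbit_space W) eps Lambda P F).
Proof.
  split; [| split].
  - intros U g gi xi gt h f X Lambda eps P S N H x0 Ux0.
    destruct (nks_open S x0 Ux0) as [d Hd].
    exact (soliton_local_form U g gi xi gt h f X Lambda eps P S N H x0 d Hd).
  - intros W eps Lambda c a1 a2 P F oW Heps data.
    exists (sol_gi eps c P F), (sol_h c), (sol_f c F). split; [| split].
    + now apply sol_null_killing_soliton.
    + now apply (sol_normal_form W eps Lambda).
    + intros t Ot. simpl. rewrite (sd_antiderivative data t Ot).
      apply Rgt_not_eq, exp_pos.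
  - intros eps Lambda _. apply soliton_data_exists.
Qed.
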